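(* Let $\alpha\in(0,1)$, let $\mathbf{x}:[0,1]^2\to T^*$ be an $\alpha$-rough path, let $N\in\mathbb{N}$ (with $N\geq 1$), and write $T_{\mathbf{c}}:=\tilde\rho_{\blacktriangleright}(\exp_{\blacktriangleright}(\mathbf{c}))$. (i) Let $\mathbf{c}\in R_{\geq 2}^{(N)}$. Then $T_{\mathbf{c}}\mathbf{x}$ is an $\alpha/N$-rough path. (ii) Let $\emptyset\neq\tilde{\mathfrak{L}}\subset\mathfrak{L}$ and $\mathbf{c}\in R_{\tilde{\mathfrak{L}}}^{(N)}$. Then $T_{\mathbf{c}}\mathbf{x}$ is an $\alpha/N$-rough path. (iii) Let $\emptyset\neq\tilde{\mathfrak{L}}\subset\mathfrak{L}$ and $\mathbf{c}\in R_{\tilde{\mathfrak{L}}}^{(N)}$. Assume in addition that for every $\mathfrak{l}\in\tilde{\mathfrak{L}}$ there exists $\alpha_{\mathfrak{l}}\geq\alpha$ such that for every $\beta\in\mathcal{T}$ $$\sup_{0\leq s<t\leq 1}\frac{|\mathbf{x}_{st\,\beta}|}{|t-s|^{|\beta|_{\tilde{\mathfrak{L}}}}}<\infty,\qquad |\beta|_{\tilde{\mathfrak{L}}}:=\sum_{\mathfrak{l}\in\tilde{\mathfrak{L}}}\alpha_{\mathfrak{l}}\sum_{k\in\mathbb{N}_0}\beta(\mathfrak{l},k)+\alpha\sum_{\mathfrak{l}\in\mathfrak{L}\setminus\tilde{\mathfrak{L}}}\sum_{k\in\mathbb{N}_0}\beta(\mathfrak{l},k).$$ Denote $\underline{\alpha}:=\min_{\mathfrak{l}\in\tilde{\mathfrak{L}}}\alpha_{\mathfrak{l}}$.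 Then $T_{\mathbf{c}}\mathbf{x}$ is a $\min\{\alpha,\underline{\alpha}/N\}$-rough path.
   Context: Multi-indices. $\mathfrak{L}$ is a finite nonempty set, $\mathbb{N}_0=\{0,1,2,\dots\}$. For a countable set $S$, $M(S)$ is the set of finitely supported functions $I:S\to\mathbb{N}_0$; $e_s$ is the indicator of $s$; $\ell(I)=\sum_s I(s)$; $I!=\prod_s I(s)!$. $\mathbb{R}[\mathfrak{L}\times\mathbb{N}_0]$ denotes polynomials in commuting variables $\mathsf{z}_{(\mathfrak{l},k)}$, with monomials $\mathsf{z}^\beta=\prod\mathsf{z}_{(\mathfrak{l},k)}^{\beta(\mathfrak{l},k)}$, and $\mathbb{R}[[\mathfrak{L}\times\mathbb{N}_0]]$ the formal power series. Put $[\beta]=\sum_{(\mathfrak{l},k)}(1-k)\beta(\mathfrak{l},k)$, $\mathcal{T}=\{\beta\in M(\mathfrak{L}\times\mathbb{N}_0):[\beta]=1\}$, $T=\mathrm{span}\{\mathsf{z}^\beta\}_{\beta\in\mathcal{T}}$, and $T^*$ the space of formal series $\sum_{\beta\in\mathcal{T}}\pi_\beta\mathsf{z}^\beta$. $D=\sum_{(\mathfrak{l},k)}(k+1)\mathsf{z}_{(\mathfrak{l},k+1)}\partial_{\mathsf{z}_{(\mathfrak{l},k)}}$; $T$ is a pre-Lie algebra under $(\pi,\pi')\mapsto\pi D\pi'=\pi\cdot(D\pi')$, denoted $(T,D)$. For $\mathbf{x}:[0,1]^2\to T^*$ write $\mathbf{x}_{st}=\sum_\beta\mathbf{x}_{st\,\beta}\mathsf{z}^\beta$.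 Guin–Oudom basis and exponential. A pre-Lie product $\triangleright$ on $L$ is bilinear with $a\triangleright(b\triangleright c)-(a\triangleright b)\triangleright c$ symmetric in $a,b$. Given a countable basis $\{a_i\}_{i\in\mathscr{I}}$ of $L$, let $U(L,\triangleright)$ be the universal enveloping algebra of $L$ with bracket $a\triangleright b-b\triangleright a$, and $\rho_\triangleright:U(L,\triangleright)\to\mathrm{End}(L)$ the algebra morphism extending $\rho_\triangleright(a)b=a\triangleright b$. Define $\star_\triangleright:U(L,\triangleright)\times L\to U(L,\triangleright)$ by $1\star_\triangleright a=a$ and $(a'U)\star_\triangleright a=a'(U\star_\triangleright a)-U\star_\triangleright(a'\triangleright a)$. For $I=e_{i_1}+\dots+e_{i_n}\in M(\mathscr{I})$ set $A_I=\frac1{I!}(\cdots((1\star_\triangleright a_{i_1})\star_\triangleright a_{i_2})\cdots)\star_\triangleright a_{i_n}$ (independent of the order); $\{A_I\}$ is a basis of $U(L,\triangleright)$. $L^*$ denotes formal series $\mathbf{f}=\sum_i\mathbf{f}_i a_i$, $\mathbf{f}^I=\prod_i\mathbf{f}_i^{I(i)}$, and $\exp_\triangleright(\mathbf{f})=\sum_I\mathbf{f}^I A_I$ (formal sum). For $(T,D)$ with basis $\{\mathsf{z}^\beta\}_{\beta\in\mathcal{T}}$ this gives $\exp_D$ and $\rho_D$; $\rho_D(\exp_D(\mathbf{f}))=\sum_I\mathbf{f}^I\rho_D(A_I)$ is a well-defined endomorphism of $T^*$ (all matrix coefficients and their action are finite sums). Rough paths. For $\alpha\in(0,1)$, an $\alpha$-rough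 path (understood as already extended to all levels) is a map $\mathbf{x}:[0,1]^2\to T^*$ such that for all $0\leq s<u<t\leq1$, $\mathbf{x}_{st}=\mathbf{x}_{su}+\rho_D(\exp_D(\mathbf{x}_{su}))\mathbf{x}_{ut}$, and for all $\beta\in\mathcal{T}$, $\sup_{0\leq s<t\leq1}|\mathbf{x}_{st\,\beta}|/|t-s|^{\alpha\ell(\beta)}<\infty$. Translations. $R=\mathrm{span}\{\mathsf{r}^{(\gamma,\mathfrak{l})}:(\gamma,\mathfrak{l})\in\mathcal{T}\times\mathfrak{L}\}$ (free symbols). For $\gamma\in\mathcal{T}$, $\mathfrak{l}\in\mathfrak{L}$ set $\tilde\rho_{\blacktriangleright}(\mathsf{r}^{(\gamma,\mathfrak{l})})=\sum_{k\in\mathbb{N}_0}(\frac1{k!}D^k\mathsf{z}^\gamma)\partial_{\mathsf{z}_{(\mathfrak{l},k)}}\in\mathrm{End}(T)$. The product $\mathsf{r}^{(\gamma,\mathfrak{l})}\blacktriangleright\mathsf{r}^{(\gamma',\mathfrak{l}')}=\sum_{\beta'}c_{\beta'}\mathsf{r}^{(\beta',\mathfrak{l}')}$, where $\tilde\rho_{\blacktriangleright}(\mathsf{r}^{(\gamma,\mathfrak{l})})\mathsf{z}^{\gamma'}=\sum_{\beta'}c_{\beta'}\mathsf{z}^{\beta'}$, is pre-Lie, and $\tilde\rho_{\blacktriangleright}$ extends uniquely to an algebra morphism $U(R,\blacktriangleright)\to\mathrm{End}(T)$. Let $R_{\geq2}=\mathrm{span}\{\mathsf{r}^{(\gamma,\mathfrak{l})}:\ell(\gamma)\geq2\}$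 and, for $\emptyset\neq\tilde{\mathfrak{L}}\subset\mathfrak{L}$, $R_{\tilde{\mathfrak{L}}}=\mathrm{span}\{\mathsf{r}^{(\gamma,\mathfrak{l})}:\mathfrak{l}\in\tilde{\mathfrak{L}},\ \sum_{\mathfrak{l}'\in\mathfrak{L}\setminus\tilde{\mathfrak{L}}}\sum_k\gamma(\mathfrak{l}',k)>0\}$; these are pre-Lie subalgebras. $R_{\geq2}^{(N)}$, $R_{\tilde{\mathfrak{L}}}^{(N)}$ are the spans of those basis elements with moreover $\ell(\gamma)\leq N$. For $\mathbf{c}=\sum\mathbf{c}_{(\gamma,\mathfrak{l})}\mathsf{r}^{(\gamma,\mathfrak{l})}$ in one of these spaces, $\tilde\rho_{\blacktriangleright}(\exp_{\blacktriangleright}(\mathbf{c}))=\sum_I\mathbf{c}^I\tilde\rho_{\blacktriangleright}(\mathsf{R}_I)$, where $\mathsf{R}_I$ is the Guin–Oudom basis over the symbols $\mathsf{r}^{(\gamma,\mathfrak{l})}$; it is a well-defined endomorphism of $T^*$. *)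

(* Defs.v *)
From HB Require Import structures.
From mathcomp Require Import all_boot all_order all_algebra finmap.
From mathcomp Require Import all_classical all_reals.
From mathcomp Require Import ereal exp.
(* The notations of monalg cannot be loaded together with those of
   mathcomp-analysis. *)
From mathcomp Require Import -(notations) monalg.

Set Implicit Arguments.
Unset Strict Implicit.
Unset Printing Implicit Defensive.

Import Order.TTheory GRing.Theory Num.Theory.

Local Open Scope classical_set_scope.
Local Open Scope ring_scope.

(* [cmonom S] plays the role of M(S), [mdeg] that of the length, and
   [malg K R] is the free R-module on K, which is the polynomial algebra with
   variables in S when K = cmonom S. *)

HB.lock Definition lext (R : realType) (K : choiceType) (V : lmodType R)
    (h : K -> V) (p : malg K R) : V :=
  \sum_(k <- msupp p) mcoeff k p *: h k.

Section MultiIndex.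
Variables (R : realType) (S : choiceType).

Definition mfact (m : cmonom S) : nat := (\prod_(s <- finsupp m) (m s)`!)%N.

Definition mpow (f : S -> R) (m : cmonom S) : R :=
  \prod_(s <- finsupp m) f s ^+ m s.

(* e_(i_1) + ... + e_(i_n) is listed as [:: i_1; ...; i_n] *)
Definition mlist (m : cmonom S) : seq S :=
  flatten [seq nseq (m s) s | s <- finsupp m].

End MultiIndex.

Section Enveloping.
Variable R : realType.

Definition bilinear_op (A B C : lmodType R) (op : A -> B -> C) : Prop :=
  (forall b, linear (op^~ b)) /\ (forall a, linear (op a)).

Definition lie_br (L : lmodType R) (tri : L -> L -> L) (a b : L) : L :=
  tri a b - tri b a.

Definition lie_to_alg (L : lmodType R) (br : L -> L -> L) (A : algType R)
    (f : L -> A) : Prop :=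
  forall a b, f (br a b) = f a * f b - f b * f a.

(* A universal enveloping algebra, by its universal property. *)
Record enveloping (L : lmodType R) (br : L -> L -> L) := Enveloping {
  env_alg :> algType R;
  env_in : {linear L -> env_alg};
  env_inB : lie_to_alg br env_in;
  env_univ : forall (A : algType R) (f : {linear L -> A}), lie_to_alg br f ->
    exists g : {lrmorphism env_alg -> A}, (forall a, g (env_in a) = f a) /\
    forall g' : {lrmorphism env_alg -> A},
      (forall a, g' (env_in a) = f a) -> g' =1 g
}.

(* When tri is a pre-Lie product the last two equations determine go_star on
   the whole enveloping algebra. *)
Record guin_oudom (L : lmodType R) (tri : L -> L -> L) := GuinOudom {
  go_env :> enveloping (lie_br tri);
  go_star : go_env -> L -> go_env;
  go_star_bilinear : bilinear_op go_star;
  go_star1 : forall a, go_star 1 a = env_in go_env a;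
  go_starM : forall a' u a,
    go_star (env_in go_env a' * u) a =
      env_in go_env a' * go_star u a - go_star u (tri a' a)
}.

(* Algebra morphisms from the enveloping algebra to End(V) that extend act. *)
Record env_rep (L : lmodType R) (br : L -> L -> L) (U : enveloping br)
    (V : lmodType R) (act : L -> V -> V) := EnvRep {
  rep_fun :> U -> V -> V;
  rep_bilinear : bilinear_op rep_fun;
  rep1 : forall v, rep_fun 1 v = v;
  repM : forall u u' v, rep_fun (u * u') v = rep_fun u (rep_fun u' v);
  rep_extends : forall a v, rep_fun (env_in U a) v = act a v
}.

End Enveloping.

Section GuinOudomExp.
Variables (R : realType) (I : choiceType).
Variables (tri : malg I R -> malg I R -> malg I R) (U : guin_oudom tri).

(* A_I; the result does not depend on the order in which mlist enumerates I *)
Definition go_basis (m : cmonom I) : U :=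
  (mfact m)%:R^-1 *: foldl (fun u i => go_star u (mkmalgU i 1)) 1 (mlist m).

(* Formal series over J are functions J -> R.  The first sum gives the matrix
   coefficients of rho (exp f), the second one their action on a formal series
   g; both are sums of finitely many nonzero terms in all the cases of
   interest (and \sum_(i \in A) is 0 when there are infinitely many). *)
Definition exp_coeff (J : choiceType) (rho : U -> malg J R -> malg J R)
    (f : I -> R) (j j' : J) : R :=
  \sum_(m \in [set: cmonom I]) mpow f m * mcoeff j (rho (go_basis m) (mkmalgU j' 1)).

Definition exp_act (J : choiceType) (rho : U -> malg J R -> malg J R)
    (f : I -> R) (g : J -> R) : J -> R :=
  fun j => \sum_(j' \in [set: J]) exp_coeff rho f j j' * g j'.

End GuinOudomExp.

Definition zindex (L : finType) : choiceType := (L * nat)%type.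

HB.lock Definition zmon (R : realType) (L : finType) (b : cmonom (zindex L)) :
  malg (cmonom (zindex L)) R := mkmalgU b 1.

Section Populated.
Variables (R : realType) (L : finType).
Local Notation zindex := (zindex L).
Local Notation zmon := (@zmon R L).
Implicit Types (s : zindex) (b : cmonom zindex).

Definition mbracket b : int :=
  \sum_(s <- finsupp b) (1 - s.2%:Z) * (b s)%:Z.

Definition populated : choiceType := {b : cmonom zindex | mbracket b == 1}.

Local Notation zpoly := (malg (cmonom zindex) R).

Definition zvar s : zpoly := zmon (ucm s).

Definition dvar s : zpoly -> zpoly :=
  lext (fun b => (b s)%:R *: zmon (divcm b (ucm s))).

Definition Dop (p : zpoly) : zpoly :=
  \sum_(s \in [set: zindex]) s.2.+1%:R *: (zvar (s.1, s.2.+1) * dvar s p).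

Local Notation Tspace := (malg populated R).

Definition zpop (b : populated) : Tspace := mkmalgU b 1.

(* The identification of T with a subspace of the polynomials.  T_of_poly
   forgets the monomials that are not populated; it is only applied to
   polynomials that have none. *)
Definition poly_of_T : Tspace -> zpoly :=
  lext (fun b : populated => zmon (val b)).
Definition T_of_poly : zpoly -> Tspace :=
  lext (fun b => oapp zpop 0 (insub b)).

Definition Dprod (p q : Tspace) : Tspace :=
  T_of_poly (poly_of_T p * Dop (poly_of_T q)).

Definition rindex : choiceType := (populated * L)%type.
Implicit Types r : rindex.

Local Notation Rspace := (malg rindex R).

Definition rsym r : Rspace := mkmalgU r 1.

Definition rho_sym r (p : Tspace) : Tspace :=
  T_of_poly (\sum_(k \in [set: nat])
    (k`!%:R^-1 *: iter k Dop (zmon (val r.1))) * dvar (r.2, k) (poly_of_T p)).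

Definition rho_tilde (c : Rspace) (p : Tspace) : Tspace :=
  lext (fun r => rho_sym r p) c.

Definition Rprod (a : Rspace) : Rspace -> Rspace :=
  lext (fun r => lext (fun b : populated => rsym (b, r.2)) (rho_tilde a (zpop r.1))).

Definition in_Rge2 (N : nat) (c : Rspace) : Prop :=
  forall r, r \in msupp c -> (2 <= mdeg (val r.1) <= N)%N.

Definition in_Rsub (Lt : {set L}) (N : nat) (c : Rspace) : Prop :=
  forall r, r \in msupp c ->
    [/\ r.2 \in Lt,
        (0 < \sum_(s <- finsupp (val r.1) | s.1 \notin Lt) val r.1 s)%N &
        (mdeg (val r.1) <= N)%N].

End Populated.

Section RoughPath.
Variables (R : realType) (L : finType).

Definition holder_bound (w : R) (f : R -> R -> R) : Prop :=
  (ereal_sup [set y : \bar R | exists s t : R, [/\ (0 <= s)%R, (s < t)%R, (t <= 1)%R &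
     y = (`|f s t| / powR `|t - s| w)%:E]] < +oo)%E.

(* Only the restriction of x to [0,1]^2 is relevant. *)
Definition rough_path (UT : guin_oudom (@Dprod R L))
    (rhoD : env_rep UT (@Dprod R L))
    (alpha : R) (x : R -> R -> populated L -> R) : Prop :=
  [/\ 0 < alpha < 1,
      forall s u t : R, 0 <= s -> s < u -> u < t -> t <= 1 ->
        forall b, x s t b = x s u b + exp_act rhoD (x s u) (x u t) b &
      forall b, holder_bound (alpha * (mdeg (val b))%:R) (fun s t => x s t b)].

Definition translate (UR : guin_oudom (@Rprod R L))
    (rhoR : env_rep UR (@rho_tilde R L))
    (c : malg (rindex L) R) (x : R -> R -> populated L -> R) :
    R -> R -> populated L -> R :=
  fun s t => exp_act rhoR (fun r => mcoeff r c) (x s t).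

Definition wlength (Lt : {set L}) (alpha : R) (al : L -> R)
    (b : cmonom (zindex L)) : R :=
  \sum_(l in Lt) al l * (\sum_(s <- finsupp b | s.1 == l) b s)%N%:R +
  alpha * (\sum_(l | l \notin Lt) \sum_(s <- finsupp b | s.1 == l) b s)%N%:R.

End RoughPath.

(* Main.v *)
From HB Require Import structures.
Require Import Defs.
From mathcomp Require Import all_boot all_order all_algebra finmap.
From mathcomp Require Import all_classical all_reals ereal exp.
From mathcomp Require Import -(notations) monalg.

(** Translation is a substitution. Write [c_l] for the polynomial collecting the
    terms [r^(gamma, l)] of [c]. The operator [T_c] is the algebra morphism which
    sends [z_(l,k)] to [z_(l,k) + D^k c_l / k!] ([exp_coeffR], [exp_actR]), and
    [rho_D (exp_D f) g] is [\sum_n f^n D^n g / n!] ([exp_actD]). The prefactor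
    [D^k / k!] is what makes the substitution commute with [D] ([trans_zD]), so
    that
      [T_c (\sum_n f^n D^n g / n!) = \sum_n (T_c f)^n D^n (T_c g) / n!].
    Applied to [f = x_su] and [g = x_ut] this is Chen's relation for [T_c x]
    ([chen_translate]).

    Both closed formulas come from one fact about the Guin-Oudom product: if the
    pre-Lie algebra acts by differential operators of first order and its product
    lets one element differentiate the coefficients of another, then multiplying
    by [a] in the sense of Guin and Oudom is multiplying by [a] with all the
    coefficients moved to the left of the derivatives ([normal_star]). The
    elements [A_I] thus act by normally ordered monomials, whose sum is computed
    with a generating function: introduce a variable [t_i] for each basis element,
    find a polynomial in [t] whose derivatives are the normally ordered products,
    read [rho (A_I)] off as the coefficient of [t^I] ([rho_go_basisE]), and
    evaluate at [t = f] ([exp_coeff_psubst]). The generating function is a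
    truncated exponential for [(T, D)] and a substitution for the translations.

    Formal series are handled through truncations. There are finitely many
    populated words of bounded length ([finite_populated]), and neither [D] nor
    products nor the substitution shorten words; a coefficient of index [b] may
    therefore be computed from the truncations at length [mdeg b], modulo
    polynomials of higher order.

    The Hoelder bounds are a count of letters ([holder_translate]). The
    substitution replaces a letter by itself and by words of length at most [N].
    In the last case each letter in [Lt] carries the exponent [al l], the others
    are left alone and carry [alpha]; in the first two cases all carry [alpha].
    The new exponent is chosen such that its product with the length of a word
    never exceeds the exponent of the letter which the word replaces. *)

Set Implicit Arguments.
Unset Strict Implicit.
Unset Printing Implicit Defensive.

Import Order.TTheory GRing.Theory Num.Theory.
Local Open Scope ring_scope.

(** * The polynomial algebra *)

Section Monomials.
Variable I : choiceType.
Implicit Types (m : cmonom I) (i : I).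

Lemma mulcm_ucmK i m : divcm (mulcm (ucm i) m) (ucm i) = m.
Proof. by apply/eqP/cmP => j; rewrite divcmE mulcmE addKn. Qed.

Lemma divcm_ucmK i m : m i != 0%N -> mulcm (ucm i) (divcm m (ucm i)) = m.
Proof.
move=> mi; apply/eqP/cmP => j; rewrite mulcmE divcmE ucmE.
by case: eqP => [<-|_]; rewrite ?subn0 // subnKC // lt0n.
Qed.

Lemma cmonom_ind (P : cmonom I -> Prop) :
  P (onecm I) -> (forall i m, P m -> P (mulcm (ucm i) m)) -> forall m, P m.
Proof.
move=> P1 PM m; have [n] := ubnP (mdeg m); elim: n m => // n IHn m.
have [/eqP|] := eqVneq (mdeg m) 0%N; first by rewrite mdeg_eq0 => /eqP ->.
move=> m0 mn; have [i mi] : exists i, m i != 0%N.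
  apply: contrapT => mi0; case/eqP: m0; rewrite mdegE big1 // => i _.
  by apply: contrapT => /eqP mi; apply: mi0; exists i.
rewrite -(divcm_ucmK mi); apply: PM; apply: IHn.
by move: mn; rewrite -{1}(divcm_ucmK mi) mdegM mdegU.
Qed.

End Monomials.

(** The polynomial algebra is used through an opaque copy of the convolution
    algebra: deciding by conversion whether two products agree unfolds both
    convolution sums, which is intractable for polynomials over polynomials. *)
Lemma poly_sealed (I : choiceType) (A : comNzRingType) :
  {P : comAlgType A & {f : malg (cmonom I) A -> P & {g : P -> malg (cmonom I) A |
    [/\ linear f, cancel f g, cancel g f, f 1 = 1 &
        {morph f : p q / p * q}]}}}.
Proof.
by exists (malg (cmonom I) A : comAlgType A), id, id.
Qed.

Definition poly (I : choiceType) (A : comNzRingType) : comAlgType A :=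
  projT1 (poly_sealed I A).

Section Seal.
Variables (I : choiceType) (A : comNzRingType).

Definition toP : malg (cmonom I) A -> poly I A := projT1 (projT2 (poly_sealed I A)).
Definition ofP : poly I A -> malg (cmonom I) A :=
  proj1_sig (projT2 (projT2 (poly_sealed I A))).

Lemma poly_sealedP :
  [/\ linear toP, cancel toP ofP, cancel ofP toP, toP 1 = 1 &
      {morph toP : p q / p * q}].
Proof. exact: (proj2_sig (projT2 (projT2 (poly_sealed I A)))). Qed.

Lemma toP_linear : linear toP.
Proof. by case: poly_sealedP. Qed.

HB.instance Definition _ :=
  GRing.isLinear.Build A (malg (cmonom I) A) (poly I A) _ toP toP_linear.

Lemma toPK : cancel toP ofP.
Proof. by case: poly_sealedP. Qed.

Lemma ofPK : cancel ofP toP.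
Proof. by case: poly_sealedP. Qed.

Lemma toP1 : toP 1 = 1.
Proof. by case: poly_sealedP. Qed.

Lemma toPM : {morph toP : p q / p * q}.
Proof. by case: poly_sealedP. Qed.

Lemma ofP_linear : linear ofP.
Proof. by move=> a p q; apply: (can_inj toPK); rewrite linearP /= !ofPK. Qed.

HB.instance Definition _ :=
  GRing.isLinear.Build A (poly I A) (malg (cmonom I) A) _ ofP ofP_linear.

End Seal.

HB.lock Definition mono (I : choiceType) (A : comNzRingType) (m : cmonom I) (a : A) :
  poly I A := toP (mkmalgU m a).

HB.lock Definition coef (I : choiceType) (A : comNzRingType) (m : cmonom I)
  (p : poly I A) : A := mcoeff m (ofP p).

HB.lock Definition psupp (I : choiceType) (A : comNzRingType) (p : poly I A) :
  {fset cmonom I} := msupp (ofP p).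

Section Coefficients.
Variables (I : choiceType) (A : comNzRingType).

Lemma coef_linear m : scalar (@coef I A m).
Proof. by move=> a p q; rewrite coef.unlock linearP mcoeffD mcoeffZ. Qed.

HB.instance Definition _ m :=
  GRing.isLinear.Build A (poly I A) A _ (@coef I A m) (coef_linear m).

Lemma coefD m : {morph @coef I A m : p q / p + q}.
Proof. exact: linearD. Qed.

Lemma coefB m : {morph @coef I A m : p q / p - q}.
Proof. exact: linearB. Qed.

Lemma coefZ m a p : coef m (a *: p) = a * @coef I A m p.
Proof. exact: linearZ. Qed.

Lemma coef_sum m (T : Type) (r : seq T) (P : pred T) (F : T -> poly I A) :
  coef m (\sum_(i <- r | P i) F i) = \sum_(i <- r | P i) coef m (F i).
Proof. exact: linear_sum. Qed.

End Coefficients.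

HB.lock Definition pder (I : choiceType) (A : comNzRingType) (i : I) (p : poly I A) :
  poly I A := \sum_(m <- psupp p) coef m p *: mono (divcm m (ucm i)) (m i)%:R.

Section Polynomials.
Variables (I : choiceType) (A : comNzRingType).
Local Notation poly := (poly I A).
Local Notation var i := (mono (ucm i) 1 : poly).
Implicit Types (m : cmonom I) (p q : poly) (i j : I) (a b : A).

Lemma polyP p q : (forall m, coef m p = coef m q) -> p = q.
Proof.
move=> pq; apply: (can_inj (@ofPK _ _)); apply/malgP => m.
by have := pq m; rewrite coef.unlock.
Qed.

Lemma coef_supp p m : m \notin psupp p -> coef m p = 0.
Proof. by rewrite coef.unlock psupp.unlock; exact: mcoeff_outdom. Qed.

Lemma psupp_neq0 p m : (m \in psupp p) = (coef m p != 0).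
Proof. by rewrite coef.unlock psupp.unlock -mcoeff_neq0. Qed.

Lemma coef_mono m a k : coef k (mono m a) = a *+ (m == k).
Proof. by rewrite coef.unlock mono.unlock toPK; exact: mcoeffU. Qed.

Lemma mul_mono a b m m' : mono m a * mono m' b = mono (mulcm m m') (a * b) :> poly.
Proof. by rewrite mono.unlock -toPM; congr toP; exact: fgmulUU. Qed.

Lemma mono1 : mono (onecm I) 1 = 1 :> poly.
Proof. by rewrite mono.unlock -toP1. Qed.

Lemma monoZ a b m : mono m (a * b) = a *: mono m b :> poly.
Proof. by apply: polyP => k; rewrite coefZ !coef_mono mulrnAr. Qed.

Lemma polyE p : p = \sum_(m <- psupp p) mono m (coef m p).
Proof.
apply: polyP => k; rewrite coef_sum.
under eq_bigr do rewrite coef_mono.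
have [kp|kp] := boolP (k \in psupp p).
  rewrite (big_fsetD1 _ kp) /= eqxx big1_fset ?addr0 // => m.
  by rewrite in_fsetD1 => /andP[/negbTE -> _].
rewrite (coef_supp kp) big1_fset // => m mp _.
by case: eqP => // mk; rewrite -mk mp in kp.
Qed.

Lemma poly_ind (P : poly -> Prop) :
  P 1 -> (forall i p, P p -> P (var i * p)) ->
  (forall a p q, P p -> P q -> P (a *: p + q)) -> forall p, P p.
Proof.
move=> P1 PM PL.
have P0 : P 0 by rewrite -(addNr 1) -scaleN1r; exact: (PL _ _ _ P1 P1).
have Pmon m : P (mono m 1).
  elim/cmonom_ind: m => [|i m IH]; first by rewrite mono1.
  by rewrite -[1]mulr1 -mul_mono; exact: (PM _ _ IH).
move=> p; rewrite [p]polyE; elim/big_rec: _ => // m q _ Pq.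
by rewrite -[coef m p]mulr1 monoZ; exact: (PL _ _ _ (Pmon m) Pq).
Qed.

Lemma coef_pder i p m :
  coef m (pder i p) = (m i).+1%:R * coef (mulcm (ucm i) m) p.
Proof.
rewrite pder.unlock coef_sum.
transitivity (\sum_(k <- psupp p) coef k p * (k i)%:R *+ (k == mulcm (ucm i) m)).
  apply: eq_bigr => k _; rewrite coefZ coef_mono -mulrnAr.
  have [ki0|ki0] := eqVneq (k i) 0%N; first by rewrite ki0 mulr0n !mul0rn.
  congr (_ * (_ *+ nat_of_bool _)); apply/eqP/eqP => [<-|->].
    by rewrite divcm_ucmK.
  by rewrite mulcm_ucmK.
have E : (mulcm (ucm i) m) i = (m i).+1 by rewrite mulcmE ucmE eqxx.
have [mp|mp] := boolP (mulcm (ucm i) m \in psupp p).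
  rewrite (big_fsetD1 _ mp) /= eqxx big1_fset ?addr0 ?mulr1n => [|k].
    by rewrite E mulrC.
  by rewrite in_fsetD1 => /andP[/negbTE -> _] _; rewrite mulr0n.
rewrite (coef_supp mp) mulr0 big1_fset // => k kp _.
by case: eqP => [ek|_]; rewrite ?mulr0n // -ek kp in mp.
Qed.

Lemma pder_is_linear i : linear (@pder I A i).
Proof.
move=> a p q; apply: polyP => m.
by rewrite [RHS]coefD coefZ !coef_pder coefD coefZ mulrDr mulrCA.
Qed.

HB.instance Definition _ i :=
  GRing.isLinear.Build A poly poly _ (@pder I A i) (pder_is_linear i).

Lemma pderZ i a p : pder i (a *: p) = a *: pder i p.
Proof. exact: linearZ. Qed.

Lemma pder_sum i (T : Type) (r : seq T) (Q : pred T) (F : T -> poly) :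
  pder i (\sum_(k <- r | Q k) F k) = \sum_(k <- r | Q k) pder i (F k).
Proof. exact: linear_sum. Qed.

Lemma pder1 i : pder i (1 : poly) = 0.
Proof.
apply: polyP => m; rewrite coef_pder linear0 -mono1 coef_mono.
case: eqP => [e|_]; last by rewrite mulr0n mulr0.
have := congr1 (fun k : cmonom I => k i) e.
by rewrite /= onecmE mulcmE ucmE eqxx.
Qed.

Lemma coef_varM i p m : coef m (var i * p) =
  if m i == 0%N then 0 else coef (divcm m (ucm i)) p.
Proof.
rewrite {1}[p]polyE mulr_sumr coef_sum.
transitivity (\sum_(k <- psupp p) coef k p *+ (mulcm (ucm i) k == m)).
  by apply: eq_bigr => k _; rewrite mul_mono mul1r coef_mono.
case: eqP => [mi|/eqP mi].
  rewrite big1 // => k _; case: eqP => // e.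
  by move: mi; rewrite -e mulcmE ucmE eqxx.
transitivity (\sum_(k <- psupp p) coef k p *+ (k == divcm m (ucm i))).
  apply: eq_bigr => k _; congr (_ *+ _); congr nat_of_bool.
  by apply/eqP/eqP => [<-|->]; rewrite ?mulcm_ucmK ?divcm_ucmK.
set k0 := divcm m _; have [kp|kp] := boolP (k0 \in psupp p).
  rewrite (big_fsetD1 _ kp) /= eqxx big1_fset ?addr0 ?mulr1n // => k.
  by rewrite in_fsetD1 => /andP[/negbTE -> _] _; rewrite mulr0n.
rewrite (coef_supp kp) big1_fset // => k kp' _.
by case: eqP => [ek|_]; rewrite ?mulr0n // ek (negbTE kp) in kp'.
Qed.

Lemma pder_varM i j p : pder i (var j * p) = (i == j)%:R *: p + var j * pder i p.
Proof.
apply: polyP => m; rewrite coef_pder coefD coefZ !coef_varM.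
rewrite coef_pder mulcmE ucmE; have [->|ij] := eqVneq i j.
  rewrite mulcm_ucmK add1n /= mul1r divcmE ucmE eqxx subn1.
  have [mj|mj] := eqVneq (m j) 0%N; first by rewrite mj mul1r addr0.
  by rewrite prednK ?lt0n // divcm_ucmK // -nat1r mulrDl mul1r.
rewrite add0n mul0r add0r; case: ifP; first by rewrite mulr0.
rewrite divcmE ucmE [j == i]eq_sym (negbTE ij) subn0 => _; congr (_ * coef _ p).
apply/eqP/cmP => k; rewrite !(mulcmE, divcmE, ucmE).
have [<-|_] := eqVneq i k; last by rewrite !add0n.
by rewrite [j == i]eq_sym (negbTE ij) !subn0.
Qed.

Lemma pder_var i j : pder i (var j) = (i == j)%:R.
Proof.
by rewrite -[var j]mulr1 pder_varM pder1 mulr0 addr0 scaler_nat.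
Qed.

Lemma pderM i p q : pder i (p * q) = pder i p * q + p * pder i q.
Proof.
elim/poly_ind: p => [|j p IH|a p p' IH IH'].
- by rewrite !mul1r pder1 mul0r add0r.
- by rewrite -!mulrA !pder_varM IH mulrDl mulrDr addrA -scalerAl -!mulrA.
- rewrite mulrDl -scalerAl !linearD !linearZ /= IH IH' !mulrDl -!scalerAl scalerDr.
  by rewrite addrACA.
Qed.

Lemma pderXn i p n : pder i (p ^+ n.+1) = n.+1%:R * (p ^+ n * pder i p).
Proof.
elim: n => [|n IH]; first by rewrite expr1 expr0 !mul1r.
rewrite exprS pderM IH -[in RHS]nat1r mulrDl mul1r; congr (_ + _).
  by rewrite mulrC.
by rewrite mulrCA [in RHS]exprS -!mulrA.
Qed.

(** Sums over the possibly infinite set of variables are finite because of this. *)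
Lemma pder_fin p : exists d : {fset I}, forall i, i \notin d -> pder i p = 0.
Proof.
elim/poly_ind: p => [|j p [d dp]|a p q [d dp] [e eq]].
- by exists fset0 => i _; rewrite pder1.
- exists (j |` d)%fset => i; rewrite inE negb_or in_fset1 => /andP[ij /dp pi0].
  by rewrite pder_varM pi0 mulr0 addr0 (negbTE ij) scale0r.
- exists (d `|` e)%fset => i; rewrite inE negb_or => /andP[/dp pi /eq qi].
  by rewrite linearP /= pi qi scaler0 addr0.
Qed.

End Polynomials.

(** * Vector fields *)

Section VectorField.
Variables (I : choiceType) (A B : comNzRingType).
Local Notation P := (poly I A).
Implicit Types (w : I -> B) (O : P -> B) (p q : P) (i : I).

(** For [O] the identity this is the vector field with components [w]. For
    general [O] it is the normally ordered product of that field with [O]: the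
    derivation acts first, then [O], and the components [w] stay on the left,
    where [O] does not see them. *)
Definition vfield w O p : B := \sum_(i \in [set: I]) w i * O (pder i p).

Lemma vfieldE w O p (d : {fset I}) : O 0 = 0 ->
  (forall i, i \notin d -> pder i p = 0) ->
  vfield w O p = \sum_(i <- d) w i * O (pder i p).
Proof. by move=> O0 dp; apply: fsbigTE => i /dp ->; rewrite O0 mulr0. Qed.

Lemma eq_vfield w O O' p : O =1 O' -> vfield w O p = vfield w O' p.
Proof. by move=> OO'; apply: eq_fsbigr => i _; rewrite OO'. Qed.

Lemma eq_vfieldl w w' O p : w =1 w' -> vfield w O p = vfield w' O p.
Proof. by move=> ww'; apply: eq_fsbigr => i _; rewrite ww'. Qed.

Variable F : {rmorphism P -> B}.

Lemma vfield_lin w a p q :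
  vfield w F (a *: p + q) = F a%:A * vfield w F p + vfield w F q.
Proof.
have [d dp] := pder_fin p; have [e eq] := pder_fin q.
have inU (i : I) : i \notin (d `|` e)%fset -> pder i p = 0 /\ pder i q = 0.
  by rewrite inE negb_or => /andP[/dp -> /eq ->].
rewrite (vfieldE w (d := (d `|` e)%fset)) ?rmorph0 => [|//|i /inU[pi qi]].
  rewrite (vfieldE w (p := p) (d := (d `|` e)%fset)) ?rmorph0 => [|//|i /inU[]//].
  rewrite (vfieldE w (p := q) (d := (d `|` e)%fset)) ?rmorph0 => [|//|i /inU[]//].
  rewrite mulr_sumr -big_split; apply: eq_bigr => i _ /=.
  by rewrite linearP /= -[a *: pder i p]mulr_algl rmorphD rmorphM mulrDr mulrCA.
by rewrite linearP /= pi qi scaler0 addr0.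
Qed.

Lemma vfield1 w : vfield w F 1 = 0.
Proof.
by rewrite (vfieldE w (d := fset0)) ?rmorph0 ?big_seq_fset0 // => i _; rewrite pder1.
Qed.

(** With [vfield_var], this reduces an identity between fields to one between
    their values on the variables. *)
Lemma vfieldM w p q :
  vfield w F (p * q) = vfield w F p * F q + F p * vfield w F q.
Proof.
have [d dp] := pder_fin p; have [e eq] := pder_fin q.
have inU (i : I) : i \notin (d `|` e)%fset -> pder i p = 0 /\ pder i q = 0.
  by rewrite inE negb_or => /andP[/dp -> /eq ->].
rewrite (vfieldE w (d := (d `|` e)%fset)) ?rmorph0 => [|//|i /inU[pi qi]].
  rewrite (vfieldE w (p := p) (d := (d `|` e)%fset)) ?rmorph0 => [|//|i /inU[]//].
  rewrite (vfieldE w (p := q) (d := (d `|` e)%fset)) ?rmorph0 => [|//|i /inU[]//].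
  rewrite mulr_sumr mulr_suml -big_split; apply: eq_bigr => i _ /=.
  by rewrite pderM rmorphD !rmorphM mulrDr mulrA mulrCA.
by rewrite pderM pi qi mul0r mulr0 addr0.
Qed.

Lemma vfield_var w i : vfield w F (mono (ucm i) 1) = w i.
Proof.
rewrite (vfieldE w (d := [fset i]%fset)) ?rmorph0 // => [|j].
  by rewrite big_seq_fset1 pder_var eqxx rmorph1 mulr1.
by rewrite in_fset1 pder_var => /negbTE ->.
Qed.

End VectorField.

Section VectorFieldAction.
Variables (I : choiceType) (A : comNzRingType).
Local Notation P := (poly I A).
Implicit Types (w : I -> P) (O : P -> P) (p q : P) (i : I).

Lemma vfield_linear w : linear (vfield w (@idfun P)).
Proof. by move=> a p q; rewrite vfield_lin /= mulr_algl. Qed.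

(** The outer field differentiates either the components of the inner one or the
    result of [O]. The first kind of term is what separates the product of the
    enveloping algebra from the normally ordered product, and it is the pre-Lie
    product of the two fields. *)
Lemma vfield_comp w w' O p : O 0 = 0 ->
  vfield w' idfun (vfield w O p) =
  vfield w (fun q => vfield w' idfun (O q)) p +
  vfield (fun i => vfield w' idfun (w i)) O p.
Proof.
move=> O0; have [d dp] := pder_fin p.
pose V : {linear P -> P} := HB.pack (vfield w' (@idfun P))
  (GRing.isLinear.Build A P P _ _ (vfield_linear w')).
rewrite !(vfieldE _ (p := p) _ dp) //; last by rewrite O0; exact: (linear0 V).
rewrite -[vfield w' _ (\sum_(_ <- _) _)]/(V _) linear_sum -big_split.
by apply: eq_bigr => i _ /=; rewrite vfieldM addrC.
Qed.

End VectorFieldAction.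

(** * Weights *)

Section Weight.
Variables (R : realType) (I : choiceType).
Implicit Types (om : I -> R) (m : cmonom I) (i : I).

Definition wt om m : R := \sum_(i <- finsupp m) om i *+ m i.

Lemma wtE om m (d : {fset I}) : (finsupp m `<=` d)%fset ->
  wt om m = \sum_(i <- d) om i *+ m i.
Proof.
move=> md; rewrite /wt (big_fset_incl _ md) // => i _.
by rewrite -cmE_neq0 negbK => /eqP ->.
Qed.

Lemma wt1 om : wt om (onecm I) = 0.
Proof. by rewrite (wtE om (d := fset0)) ?big_seq_fset0 // mdom1. Qed.

Lemma wtM om m m' : wt om (mulcm m m') = wt om m + wt om m'.
Proof.
have e : finsupp (mulcm m m') = (finsupp m `|` finsupp m')%fset by exact: mdomD.
rewrite (wtE om (d := (finsupp m `|` finsupp m')%fset)) ?e ?fsubset_refl //.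
rewrite (wtE om (fsubsetUl (finsupp m) (finsupp m'))).
rewrite (wtE om (fsubsetUr (finsupp m) (finsupp m'))) -big_split.
by apply: eq_bigr => i _; rewrite mulcmE mulrnDr.
Qed.

Lemma wtU om i : wt om (ucm i) = om i.
Proof. by rewrite /wt mdomU big_seq_fset1 ucmE eqxx. Qed.

Lemma wtZ c om m : wt (fun i => c * om i) m = c * wt om m.
Proof. by rewrite /wt mulr_sumr; apply: eq_bigr => i _; rewrite mulrnAr. Qed.

Lemma wt_mdeg m : wt (fun=> 1) m = (mdeg m)%:R.
Proof. by rewrite /wt mdegE natr_sum. Qed.

End Weight.

Section Filtration.
Variables (R : realType) (I : choiceType) (A : comNzRingType) (om : I -> R).
Local Notation P := (poly I A).
Implicit Types (p q : P) (v : R).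

(** Three filtrations are instances: weight [-1] for each letter gives the order
    of vanishing, weights [1 - k] and [k - 1] together give homogeneity for the
    bracket, and Hoelder exponents as weights control the analytic bounds. *)
Definition filt v p := forall m, coef m p != 0 -> wt om m <= v.

Lemma filtP v p m : filt v p -> v < wt om m -> coef m p = 0.
Proof. by move=> pv vm; apply/eqP; apply: contraTT vm => /pv; rewrite leNgt. Qed.

Lemma filt_le v v' p : v <= v' -> filt v p -> filt v' p.
Proof. by move=> vv' pv m /pv /le_trans; exact. Qed.

Lemma filt0 v : filt v (0 : P).
Proof. by move=> m; rewrite linear0 eqxx. Qed.

Lemma filtD v p q : filt v p -> filt v q -> filt v (p + q).
Proof.
move=> pv qv m; rewrite coefD; have [->|/pv//] := eqVneq (coef m p) 0.
by rewrite add0r => /qv.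
Qed.

Lemma filtZ v a p : filt v p -> filt v (a *: p).
Proof.
move=> pv m; rewrite coefZ => am; apply: pv.
by apply: contraNN am => /eqP ->; rewrite mulr0.
Qed.

Lemma filt_sum v (T : eqType) (r : seq T) (F : T -> P) :
  (forall i, i \in r -> filt v (F i)) -> filt v (\sum_(i <- r) F i).
Proof.
by move=> Fv; rewrite big_seq; elim/big_ind: _ => [|p q|//];
  [exact: filt0|exact: filtD].
Qed.

Lemma filt_mono v m a : wt om m <= v -> filt v (mono m a : P).
Proof.
by move=> mv k; rewrite coef_mono; case: (m =P k) => [<-|_]; rewrite ?mulr0n ?eqxx.
Qed.

Lemma filt1 : filt 0 (1 : P).
Proof. by rewrite -mono1; apply: filt_mono; rewrite wt1. Qed.

Lemma filtM v v' p q : filt v p -> filt v' q -> filt (v + v') (p * q).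
Proof.
move=> pv qv; rewrite [p]polyE [q]polyE mulr_suml.
apply: filt_sum => m; rewrite psupp_neq0 => /pv mv.
rewrite mulr_sumr; apply: filt_sum => m'; rewrite psupp_neq0 => /qv mv'.
by rewrite mul_mono; apply: filt_mono; rewrite wtM lerD.
Qed.

Lemma filtX v p n : filt v p -> filt (v *+ n) (p ^+ n).
Proof.
move=> pv; elim: n => [|n IH]; first by rewrite expr0 mulr0n; exact: filt1.
by rewrite exprS mulrS; exact: filtM.
Qed.

Lemma filt_pder v i p : filt v p -> filt (v - om i) (pder i p).
Proof.
move=> pv m; rewrite coef_pder => /eqP m0.
rewrite lerBrDl -(wtU om i) -wtM; apply: pv.
by apply/eqP => e; apply: m0; rewrite e mulr0.
Qed.

Lemma filt_vfield d v (w : I -> P) p : (forall i, filt (om i + d) (w i)) ->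
  filt v p -> filt (v + d) (vfield w idfun p).
Proof.
move=> wd pv; have [e ep] := pder_fin p.
rewrite (vfieldE _ _ ep) //; apply: filt_sum => i _ /=.
have -> : v + d = om i + d + (v - om i) by rewrite [RHS]addrC addrA subrK.
by apply: filtM; [exact: wd|exact: filt_pder].
Qed.

End Filtration.

(** Weights add up over the letters of a monomial, so a substitution respects
    the weights as soon as it does so on each variable. *)
Lemma filt_morph (R : realType) (I J : choiceType) (A : comNzRingType)
    (om : I -> R) (om' : J -> R) (F : {lrmorphism poly I A -> poly J A}) v p :
  (forall i, filt om' (om i) (F (mono (ucm i) 1))) ->
  filt om v p -> filt om' v (F p).
Proof.
move=> Fom pv; have Fm m : filt om' (wt om m) (F (mono m 1)).
  elim/cmonom_ind: m => [|i m IH].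
    by rewrite mono1 rmorph1 wt1; exact: filt1.
  by rewrite -[1]mulr1 -mul_mono rmorphM wtM wtU; exact: filtM.
rewrite [p]polyE linear_sum; apply: filt_sum => m; rewrite psupp_neq0 => /pv mv.
rewrite -[coef m p]mulr1 monoZ linearZ /=; apply: filtZ.
exact: filt_le mv (Fm m).
Qed.

(** * Substitution *)

Section Substitution.
Variables (I : choiceType) (A S : comNzRingType).
Implicit Types (g : I -> S) (m : cmonom I) (p q : poly I A).

Definition monval g m : S := \prod_(i <- finsupp m) g i ^+ m i.

Lemma monvalE g m (d : {fset I}) : (finsupp m `<=` d)%fset ->
  monval g m = \prod_(i <- d) g i ^+ m i.
Proof.
move=> md; rewrite /monval (big_fset_incl _ md) // => i _.
by rewrite -cmE_neq0 negbK => /eqP ->.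
Qed.

Lemma monval1 g : monval g (onecm I) = 1.
Proof. by rewrite (monvalE g (d := fset0)) ?big_seq_fset0 // mdom1. Qed.

Lemma monvalM g m m' : monval g (mulcm m m') = monval g m * monval g m'.
Proof.
have e : finsupp (mulcm m m') = (finsupp m `|` finsupp m')%fset by exact: mdomD.
rewrite (monvalE g (d := (finsupp m `|` finsupp m')%fset)) ?e ?fsubset_refl //.
rewrite (monvalE g (fsubsetUl (finsupp m) (finsupp m'))).
rewrite (monvalE g (fsubsetUr (finsupp m) (finsupp m'))) -big_split.
by apply: eq_bigr => i _; rewrite mulcmE exprD.
Qed.

Lemma monvalU g i : monval g (ucm i) = g i.
Proof. by rewrite /monval mdomU big_seq_fset1 ucmE eqxx. Qed.

Lemma psubst_exists (f : {rmorphism A -> S}) g :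
  {F : {rmorphism poly I A -> S} |
    forall p, F p = \sum_(m <- psupp p) f (coef m p) * monval g m}.
Proof.
pose F (p : poly I A) := \sum_(m <- psupp p) f (coef m p) * monval g m.
have FE p (d : {fset cmonom I}) : (psupp p `<=` d)%fset ->
    F p = \sum_(m <- d) f (coef m p) * monval g m.
  move=> pd; rewrite /F (big_fset_incl _ pd) // => m _ /coef_supp ->.
  by rewrite rmorph0 mul0r.
have FD : {morph F : p q / p + q}.
  move=> p q; pose d := (psupp p `|` psupp q `|` psupp (p + q))%fset.
  have sub (X Y Z : {fset cmonom I}) (U := (X `|` Y `|` Z)%fset) :
      [/\ X `<=` U, Y `<=` U & Z `<=` U]%fset.
    by split; apply/fsubsetP => m mX; rewrite !inE mX ?orbT.
  have [sp sq spq] := sub (psupp p) (psupp q) (psupp (p + q)).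
  rewrite (FE _ _ sp) (FE _ _ sq) (FE _ _ spq) -big_split.
  by apply: eq_bigr => m _; rewrite coefD rmorphD mulrDl.
have F0 : F 0 = 0.
  by apply: (addrI (F 0)); rewrite -FD !addr0.
have Fmono m a : F (mono m a) = f a * monval g m.
  rewrite (FE _ [fset m]%fset) ?big_seq_fset1 ?coef_mono ?eqxx //.
  apply/fsubsetP => k; rewrite psupp_neq0 coef_mono in_fset1.
  by have [//|_] := eqVneq k m; rewrite mulr0n eqxx.
have F1 : F 1 = 1 by rewrite -mono1 Fmono rmorph1 monval1 mulr1.
have FM : {morph F : p q / p * q}.
  have Fs (T : eqType) (r : seq T) (G : T -> poly I A) :
    F (\sum_(i <- r) G i) = \sum_(i <- r) F (G i) by exact: (big_morph F FD F0).
  move=> p q; rewrite {1}[p]polyE {1}[q]polyE mulr_suml Fs [F p]/F mulr_suml.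
  apply: eq_bigr => m _; rewrite mulr_sumr Fs [F q]/F mulr_sumr.
  apply: eq_bigr => m' _.
  by rewrite mul_mono Fmono rmorphM monvalM mulrACA.
have FB : zmod_morphism F.
  have FN p : F (- p) = - F p.
    by apply: (addrI (F p)); rewrite -FD !subrr.
  by move=> p q; rewrite FD FN.
pose F' : {rmorphism poly I A -> S} := HB.pack F
  (GRing.isZmodMorphism.Build (poly I A) S F FB)
  (GRing.isMonoidMorphism.Build (poly I A) S F (F1, FM)).
by exists F'.
Qed.

Definition psubst (f : {rmorphism A -> S}) g : {rmorphism poly I A -> S} :=
  proj1_sig (psubst_exists f g).

Lemma psubstE f g p :
  psubst f g p = \sum_(m <- psupp p) f (coef m p) * monval g m.
Proof. exact: (proj2_sig (psubst_exists f g)). Qed.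

Lemma psubst_mono f g m a : psubst f g (mono m a) = f a * monval g m.
Proof.
have [->|a0] := eqVneq a 0.
  have -> : mono m 0 = 0 :> poly I A.
    by apply: polyP => k; rewrite coef_mono linear0 mul0rn.
  by rewrite !rmorph0 mul0r.
have -> : psubst f g (mono m a) =
    \sum_(k <- [fset m]%fset) f (coef k (mono m a)) * monval g k.
  rewrite psubstE; apply: congr_big => //; congr enum_fset; apply/fsetP => k.
  rewrite psupp_neq0 coef_mono in_fset1.
  by have [_|_] := eqVneq k m; rewrite ?mulr0n ?eqxx.
by rewrite big_seq_fset1 coef_mono eqxx.
Qed.

Lemma psubst_var f g i : psubst f g (mono (ucm i) 1) = g i.
Proof. by rewrite psubst_mono rmorph1 mul1r monvalU. Qed.

Lemma psubstC f g a : psubst f g a%:A = f a.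
Proof. by rewrite -mono1 -monoZ mulr1 psubst_mono monval1 mulr1. Qed.

End Substitution.

(** * Taylor coefficients as iterated derivatives *)

Section Taylor.
Variables (I : choiceType) (A : comNzRingType).
Implicit Types (m : cmonom I) (w : seq I) (F : poly I A).

Lemma mfactE m (d : {fset I}) : (finsupp m `<=` d)%fset ->
  mfact m = (\prod_(i <- d) (m i)`!)%N.
Proof.
move=> md; rewrite /mfact (big_fset_incl _ md) // => i _.
by rewrite -cmE_neq0 negbK => /eqP ->.
Qed.

Lemma mfact1 : mfact (onecm I) = 1%N.
Proof. by rewrite (mfactE (d := fset0)) ?big_seq_fset0 // mdom1. Qed.

Lemma mfactU i m : mfact (mulcm (ucm i) m) = ((m i).+1 * mfact m)%N.
Proof.
pose d := (i |` finsupp m)%fset.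
have md : (finsupp m `<=` d)%fset by exact: fsubsetU1.
have imd : (finsupp (mulcm (ucm i) m) `<=` d)%fset.
  have -> : finsupp (mulcm (ucm i) m) = d by rewrite mdomD mdomU.
  exact: fsubset_refl.
have id : i \in d by exact: fset1U1.
rewrite (mfactE md) (mfactE imd) (big_fsetD1 i id) [in RHS](big_fsetD1 i id).
rewrite mulcmE ucmE eqxx factS mulnA; congr (_ * _)%N.
rewrite big_seq [RHS]big_seq; apply: eq_bigr => j.
rewrite in_fsetD1 => /andP[ji _].
by rewrite mulcmE ucmE eq_sym (negbTE ji).
Qed.

Definition wordm w : cmonom I := foldr (fun i m => mulcm (ucm i) m) (onecm I) w.

Lemma wordmE w i : wordm w i = count_mem i w.
Proof.
by elim: w => [|j w IH] /=; rewrite ?onecmE // mulcmE ucmE IH.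
Qed.

Lemma count_mlist m i : count_mem i (mlist m) = m i.
Proof.
rewrite /mlist count_flatten -map_comp sumnE big_map.
under eq_bigr do rewrite /= count_nseq /=.
have [im|im] := boolP (i \in finsupp m).
  rewrite (big_fsetD1 _ im) /= eqxx mul1n big1_fset ?addn0 // => j.
  by rewrite in_fsetD1 => /andP[/negbTE -> _].
rewrite big1_fset => [|j jm _]; first by rewrite fsfun_dflt.
by case: eqP => // ji; rewrite -ji jm in im.
Qed.

Lemma wordm_mlist m : wordm (mlist m) = m.
Proof. by apply/eqP/cmP => i; rewrite wordmE count_mlist. Qed.

Lemma mem_mlist m i : (i \in mlist m) = (i \in finsupp m).
Proof. by rewrite -has_pred1 has_count count_mlist -cmE_neq0 lt0n. Qed.

Lemma size_mlist m : size (mlist m) = mdeg m.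
Proof.
rewrite /mlist size_flatten /shape -map_comp sumnE big_map mdegE.
by apply: eq_bigr => i _; rewrite /= size_nseq.
Qed.

Lemma coef_iter_pder w m F :
  (mfact m)%:R * coef m (foldr (@pder I A) F w) =
  (mfact (mulcm m (wordm w)))%:R * coef (mulcm m (wordm w)) F.
Proof.
elim: w m => [|i w IH] m /=; first by rewrite mulcm0.
rewrite coef_pder mulrA -natrM mulnC -mfactU IH.
by rewrite mulcmA [mulcm (ucm i) m]mulcmC.
Qed.

(** [mlist m] lists the variables of [m] with multiplicity, so the left-hand side
    is the derivative of multi-index [m] at the origin. *)
Lemma coef_taylor m F :
  coef (onecm I) (foldr (@pder I A) F (mlist m)) = (mfact m)%:R * coef m F.
Proof.
have := coef_iter_pder (mlist m) (onecm I) F.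
by rewrite mfact1 mul1r mul0cm wordm_mlist.
Qed.

End Taylor.

(** * Generating functions *)

(** With [e i = D^i p / i!] this is a truncation of
    [exp ((\sum_j t_j g_j) D) p] in which the [g_j] stay on the left of [D]; the
    variables [t_j] are those of [poly J A]. *)
HB.lock Definition expser (J : choiceType) (A : comNzRingType) (X : {fset J})
    (g : J -> A) (n : nat) (e : nat -> A) : poly J A :=
  \sum_(i < n.+1) e i *: (\sum_(j <- X) g j *: mono (ucm j) 1) ^+ i.

Section ExponentialSeries.
Variables (J : choiceType) (A : comNzRingType) (X : {fset J}) (g : J -> A).
Local Notation B := (poly J A).
Implicit Types (j : J) (e : nat -> A) (m : cmonom J) (F : B).

Let tvar : B := \sum_(j <- X) g j *: mono (ucm j) 1.

Let expserE n e : expser X g n e = \sum_(i < n.+1) e i *: tvar ^+ i.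
Proof. by rewrite expser.unlock. Qed.

Lemma eq_expser n e e' : e =1 e' -> expser X g n e = expser X g n e'.
Proof. by move=> ee'; rewrite !expserE; apply: eq_bigr => i _; rewrite ee'. Qed.

Let coef_tvarM m F : coef m (tvar * F) =
  \sum_(j <- X) g j * (if m j == 0%N then 0 else coef (divcm m (ucm j)) F).
Proof.
rewrite mulr_suml coef_sum; apply: eq_bigr => j _.
by rewrite -scalerAl coefZ coef_varM.
Qed.

Let coef_tvarX m i : mdeg m != i -> coef m (tvar ^+ i) = 0.
Proof.
elim: i m => [|i IH] m mi.
  rewrite expr0 -mono1 coef_mono.
  case: (onecm J =P m) mi => [<-|_ _]; last by rewrite mulr0n.
  by rewrite mdeg1.
rewrite exprS coef_tvarM big1 // => j _.
have [mj|mj] := eqVneq (m j) 0%N; first by rewrite mulr0.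
rewrite IH ?mulr0 //; apply: contra mi => /eqP <-.
by rewrite -{1}(divcm_ucmK mj) mdegM mdegU.
Qed.

Lemma coef_expser_const n e : coef (onecm J) (expser X g n e) = e 0%N.
Proof.
rewrite expserE big_ord_recl coefD coefZ expr0 -mono1 coef_mono eqxx mulr1.
rewrite coef_sum big1 ?addr0 // => i _.
by rewrite coefZ coef_tvarX ?mulr0 // mdeg1.
Qed.

Lemma coef_expser_big n e m : (n < mdeg m)%N -> coef m (expser X g n e) = 0.
Proof.
move=> nm; rewrite expserE coef_sum big1 // => i _.
rewrite coefZ coef_tvarX ?mulr0 // neq_ltn; apply/orP; right.
exact: leq_ltn_trans (leq_ord i) nm.
Qed.

(** Differentiating the exponential in [t_j] brings out [g j] on the left and
    replaces [p] by [D p]; the truncation costs one order. *)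
Lemma pder_expser j n e (ev : {scalar B}) : j \in X ->
  ev (pder j (expser X g n.+1 e)) =
  g j * ev (expser X g n (fun i => i.+1%:R * e i.+1)).
Proof.
move=> jX; have tj : pder j tvar = (g j)%:A.
  rewrite /tvar pder_sum (big_fsetD1 _ jX) /= pderZ pder_var eqxx.
  rewrite big1_fset ?addr0 // => k; rewrite in_fsetD1 => /andP[kj _] _.
  by rewrite pderZ pder_var eq_sym (negbTE kj) scaler0.
have evZ a F : ev (a *: F) = a * ev F by exact: linearZ.
rewrite -evZ; congr (ev _).
rewrite !expserE pder_sum big_ord_recl pderZ expr0 pder1 scaler0 add0r.
rewrite scaler_sumr; apply: eq_bigr => i _ /=.
rewrite pderZ pderXn tj mulr_algr mulr_natl -scaler_nat !scalerA.
by congr (_ *: _); rewrite mulrC mulrA mulrAC mulrA.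
Qed.

Lemma psubst_expser n e (h : J -> A) :
  psubst idfun h (expser X g n e) =
  \sum_(i < n.+1) e i * (\sum_(j <- X) g j * h j) ^+ i.
Proof.
have psZ a F : psubst idfun h (a *: F) = a * psubst idfun h F.
  by rewrite -mulr_algl rmorphM psubstC.
rewrite expserE rmorph_sum; apply: eq_bigr => i _ /=.
rewrite psZ rmorphXn rmorph_sum; congr (_ * _ ^+ _).
by apply: eq_bigr => j _ /=; rewrite psZ psubst_var.
Qed.

End ExponentialSeries.

HB.lock Definition shiftvar (I J : choiceType) (A : comNzRingType) (X : {fset J})
    (z : I -> A) (W : J -> I -> A) (i : I) : poly J A :=
  (z i)%:A + \sum_(j <- X) W j i *: mono (ucm j) 1.

Section Shift.
Variables (I J : choiceType) (A0 A : comNzRingType) (f : {rmorphism poly I A0 -> A}).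
Variables (X : {fset J}) (W : J -> I -> A).
Local Notation B := (poly J A).
Local Notation z i := (f (mono (ucm i) 1)).

Let f0 : {rmorphism A0 -> A} := GRing.RMorphism.clone _ _ (f \o in_alg (poly I A0)) _.

Let fB : {rmorphism A0 -> B} := GRing.RMorphism.clone _ _ (in_alg B \o f0) _.

(** Taylor's formula makes this substitution the generating function of the
    normally ordered products of the fields [W j]. *)
Definition shift : {rmorphism poly I A0 -> B} :=
  psubst fB (shiftvar X (fun i => z i) W).

Let shiftZ a p : shift (a *: p) = f a%:A *: shift p.
Proof. by rewrite -[a *: p]mulr_algl rmorphM [X in X * _]psubstC /= mulr_algl. Qed.

Lemma coef_shift_const p : coef (onecm J) (shift p) = f p.
Proof.
elim/poly_ind: p => [|i p IH|a p q IHp IHq].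
- by rewrite !rmorph1 -mono1 coef_mono eqxx.
- rewrite rmorphM /= psubst_var shiftvar.unlock mulrDl mulr_algl coefD coefZ IH.
  rewrite mulr_suml coef_sum big1 ?addr0 ?rmorphM // => j _.
  by rewrite -scalerAl coefZ coef_varM onecmE eqxx mulr0.
- rewrite rmorphD shiftZ coefD coefZ IHp IHq [RHS]rmorphD.
  by rewrite -[a *: p]mulr_algl [in RHS]rmorphM.
Qed.

(** The chain rule. The scalar map [ev] commutes with the components [W j], which
    are constants for the variables [t]. *)
Lemma pder_shift j p (ev : {scalar B}) : j \in X ->
  ev (pder j (shift p)) = vfield (W j) (fun q => ev (shift q)) p.
Proof.
move=> jX; pose Wc i : B := (W j i)%:A.
have -> : pder j (shift p) = vfield Wc shift p.
  elim/poly_ind: p => [|i p IH|a p q IHp IHq].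
  - by rewrite rmorph1 pder1 vfield1.
  - rewrite rmorphM pderM IH vfieldM vfield_var /= psubst_var; congr (_ * _ + _).
    rewrite shiftvar.unlock linearD /= pderZ pder1 scaler0 add0r pder_sum.
    rewrite (big_fsetD1 _ jX) /= pderZ pder_var eqxx.
    rewrite big1_fset ?addr0 // => k; rewrite in_fsetD1 => /andP[kj _] _.
    by rewrite pderZ pder_var eq_sym (negbTE kj) scaler0.
  - rewrite vfield_lin rmorphD shiftZ linearD /= pderZ IHp IHq.
    by rewrite [X in X * _]psubstC /= mulr_algl.
have [d dp] := pder_fin p.
rewrite (vfieldE _ _ dp) ?rmorph0 // (vfieldE _ _ dp) ?rmorph0 ?linear0 //.
rewrite linear_sum; apply: eq_bigr => i _ /=.
by rewrite mulr_algl linearZ.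
Qed.

Lemma psubst_shift (h : J -> A) p :
  psubst idfun h (shift p) =
  psubst f0 (fun i => z i + \sum_(j <- X) W j i * h j) p.
Proof.
have psZ a F : psubst idfun h (a *: F) = a * psubst idfun h F.
  by rewrite -mulr_algl rmorphM psubstC.
elim/poly_ind: p => [|i p IH|a p q IHp IHq].
- by rewrite !rmorph1.
- rewrite !rmorphM IH /= !psubst_var; congr (_ * _).
  rewrite shiftvar.unlock rmorphD psZ rmorph1 mulr1 rmorph_sum; congr (_ + _).
  by apply: eq_bigr => j _ /=; rewrite psZ psubst_var.
- by rewrite !rmorphD shiftZ psZ IHp IHq -[a *: p]mulr_algl rmorphM /= psubstC.
Qed.

End Shift.

(** * Normal ordering of the Guin-Oudom product *)

(** An element [a] of the pre-Lie algebra acts by a differential operator of first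
    order, and [M a O] stands for its product with the operator [O] in which the
    coefficients of [a] are kept on the left of [O]. *)
Section NormalOrdering.
Variables (R : realType) (L : lmodType R) (tri : L -> L -> L).
Variables (U : guin_oudom tri) (V : lmodType R) (act : L -> V -> V).
Variables (rho : env_rep U act) (P : lmodType R) (iota : V -> P).
Variable M : L -> (P -> P) -> P -> P.
Hypothesis iota_linear : linear iota.
Hypothesis M_ext : forall a O O', O =1 O' -> M a O =1 M a O'.
Hypothesis M_lin : forall a c O O' p, linear O -> linear O' ->
  M a (fun q => c *: O q + O' q) p = c *: M a O p + M a O' p.
Hypothesis M_linear : forall a, linear (M a idfun).
Hypothesis M_act : forall a v, iota (act a v) = M a idfun (iota v).
Hypothesis M_pre : forall a a' O p, linear O ->
  M a' idfun (M a O p) = M a (fun q => M a' idfun (O q)) p + M (tri a' a) O p.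

(** [normal u O] says that [O] is built in parallel with [u]. It is an inductive
    relation, and not the equality of the actions of [u] and [O], because [u] is
    needed to compute [go_star u a]: a representation need not be faithful. It
    reaches the subalgebra generated by the pre-Lie algebra, where all the
    elements [A_I] live. *)
Inductive normal : U -> (P -> P) -> Prop :=
| Normal1 : normal 1 idfun
| NormalM a u O : normal u O -> normal (env_in U a * u) (fun p => M a idfun (O p))
| NormalL c u v O O' : normal u O -> normal v O' ->
    normal (c *: u + v) (fun p => c *: O p + O' p)
| NormalE u O O' : normal u O -> O =1 O' -> normal u O'.

Lemma normal_linear u O : normal u O -> linear O.
Proof.
elim=> {u O} [//|a u O _ IH c p q|c u v O O' _ IH _ IH' d p q|u O O' _ IH e c p q].
- by rewrite IH M_linear.
- rewrite IH IH' !scalerDr !scalerA [c * d]mulrC -!addrA; congr (_ + _).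
  by rewrite addrCA.
- by rewrite -!e IH.
Qed.

Lemma normal_rho u O : normal u O -> forall v, iota (rho u v) = O (iota v).
Proof.
have [rhoL _] := rep_bilinear rho.
elim=> {u O} [v|a u O _ IH v|c u v O O' _ IH _ IH' x|u O O' _ IH e v].
- by rewrite rep1.
- by rewrite repM rep_extends M_act IH.
- by rewrite (rhoL x) iota_linear IH IH'.
- by rewrite IH e.
Qed.

(** The Guin-Oudom product is the normally ordered product. By induction on [u]:
    the recursion [(a' u) * a = a' (u * a) - u * (a' . a)] subtracts exactly the
    terms of [M_pre] in which [a'] differentiates the coefficients of [a]. *)
Lemma normal_star a u O : normal u O -> normal (go_star u a) (M a O).
Proof.
have [starL _] := go_star_bilinear U.
move=> uO; elim: uO a => {u O}
  [a|a' u O uO IH a|c u v O O' uO IH vO IH' a|u O O' _ IH e a].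
- rewrite go_star1 -[env_in U a]mulr1.
  exact: NormalE (NormalM a Normal1) _.
- rewrite go_starM addrC -scaleN1r.
  apply: NormalE (NormalL (-1) (IH (tri a' a)) (NormalM a' (IH a))) _ => p.
  by rewrite (M_pre a a' _ (normal_linear uO)) scaleN1r addrC addrK.
- rewrite (starL a); apply: NormalE (NormalL c (IH a) (IH' a)) _ => p.
  by rewrite (M_lin a c p (normal_linear uO) (normal_linear vO)).
- exact: NormalE (IH a) (M_ext a e).
Qed.

End NormalOrdering.

Section GeneratingFunction.
Variables (R : realType) (J K I : choiceType).
Variables (tri : malg J R -> malg J R -> malg J R) (U : guin_oudom tri).
Variables (act : malg J R -> malg K R -> malg K R) (rho : env_rep U act).
Local Notation P := (poly I R).
Variables (iota : malg K R -> P) (M : malg J R -> (P -> P) -> P -> P).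
Hypothesis iota_linear : linear iota.
Hypothesis M_ext : forall a O O', O =1 O' -> M a O =1 M a O'.
Hypothesis M_lin : forall a c O O' p, linear O -> linear O' ->
  M a (fun q => c *: O q + O' q) p = c *: M a O p + M a O' p.
Hypothesis M_linear : forall a, linear (M a idfun).
Hypothesis M_act : forall a v, iota (act a v) = M a idfun (iota v).
Hypothesis M_pre : forall a a' O p, linear O ->
  M a' idfun (M a O p) = M a (fun q => M a' idfun (O q)) p + M (tri a' a) O p.

Definition word_op (w : seq J) : P -> P :=
  foldl (fun O i => M (mkmalgU i 1) O) idfun w.

Lemma rho_go_basis m v :
  iota (rho (go_basis U m) v) = (mfact m)%:R^-1 *: word_op (mlist m) (iota v).
Proof.
have [rhoL _] := rep_bilinear rho.
have n : normal M (foldl (fun u i => go_star u (mkmalgU i 1)) (1 : U) (mlist m))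
    (word_op (mlist m)).
  elim/last_ind: (mlist m) => [|w i IH]; first exact: Normal1.
  rewrite /word_op !foldl_rcons.
  exact: (normal_star M_ext M_lin M_linear M_pre).
have iotaZ c x : iota (c *: x) = c *: iota x.
  have iota0 : iota 0 = 0 by have := iota_linear (-1) 0 0;
    rewrite scaleN1r oppr0 addr0 scaleN1r addNr.
  by rewrite -[c *: x]addr0 iota_linear iota0 addr0.
have rhoZ c u x : rho (c *: u) x = c *: rho u x.
  have rho0 : rho 0 x = 0 by have := rhoL x (-1) 0 0;
    rewrite scaleN1r oppr0 addr0 scaleN1r addNr.
  by rewrite -[c *: u]addr0 (rhoL x) rho0 addr0.
by rewrite /go_basis rhoZ iotaZ (normal_rho rho iota_linear M_act n).
Qed.

(** A family of generating functions, in variables [t_i] for [i] in [X], whose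
    derivative in [t_i] is the normally ordered product by the basis element [i].
    The index counts how many times it may be differentiated, which leaves room
    for truncated exponentials. *)
Variables (X : pred J) (Theta : nat -> P -> poly J P).
Hypothesis Theta_const : forall n p, coef (onecm J) (Theta n p) = p.
Hypothesis Theta_pder : forall i n p (ev : {scalar poly J P}), X i ->
  M (mkmalgU i 1) (fun q => ev (Theta n q)) p = ev (pder i (Theta n.+1 p)).

Lemma iter_pder_scalar w :
  scalar (fun F : poly J P => coef (onecm J) (foldr (@pder J P) F w)).
Proof.
by elim/last_ind: w => [|w i IH] a F G; rewrite ?foldr_rcons linearP //= IH.
Qed.

Lemma word_op_Theta w n p : all X w ->
  word_op w p = coef (onecm J) (foldr (@pder J P) (Theta (size w + n) p) w).
Proof.
elim/last_ind: w p => [|w i IH] p; first by rewrite Theta_const.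
rewrite all_rcons => /andP[Xi Xw]; rewrite /word_op foldl_rcons -/(word_op w).
pose ev : {scalar poly J P} := HB.pack
  (fun F : poly J P => coef (onecm J) (foldr (@pder J P) F w))
  (GRing.isLinear.Build P (poly J P) P _ _ (iter_pder_scalar w)).
have e : word_op w =1 (fun q => ev (Theta (size w + n)%N q)).
  by move=> q; exact: IH.
by rewrite (M_ext _ e) Theta_pder // size_rcons addSn foldr_rcons.
Qed.

(** Both sides satisfy the same recursion on words: [normal_star] for the
    Guin-Oudom basis, differentiation for the generating function. The factor
    [1 / m!] of [go_basis] turns a derivative at the origin into a coefficient. *)
Lemma rho_go_basisE m n v : all X (mlist m) ->
  iota (rho (go_basis U m) v) = coef m (Theta (mdeg m + n) (iota v)).
Proof.
move=> Xm; rewrite rho_go_basis (word_op_Theta n _ Xm) coef_taylor size_mlist.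
rewrite mulr_natl -scaler_nat scalerA mulVf ?scale1r //.
rewrite pnatr_eq0 -lt0n /mfact; apply: prodn_gt0 => i; exact: fact_gt0.
Qed.

End GeneratingFunction.

(** Summing against [mpow g] is evaluating the generating function at [t = g].
    The values [g] may differ from [f] where the coefficients vanish, which
    allows [f] to have infinite support. *)
Lemma exp_coeff_psubst (R : realType) (J K I : choiceType)
    (tri : malg J R -> malg J R -> malg J R) (U : guin_oudom tri)
    (rho : U -> malg K R -> malg K R) (f g : J -> R) (j k : K)
    (m0 : cmonom I) (F : poly J (poly I R)) :
  (forall m, mpow f m * mcoeff j (rho (go_basis U m) (mkmalgU k 1)) =
     mpow g m * coef m0 (coef m F)) ->
  exp_coeff rho f j k = coef m0 (psubst idfun (fun i => (g i)%:A) F).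
Proof.
move=> fgE; rewrite /exp_coeff; under eq_fsbigr do rewrite fgE.
rewrite (fsbigTE (psupp F)) => [|m /coef_supp ->]; last by rewrite linear0 mulr0.
rewrite psubstE coef_sum; apply: eq_bigr => m _ /=.
have -> : monval (fun i => (g i)%:A : poly I R) m = (mpow g m)%:A.
  rewrite /monval /mpow -[RHS]/(in_alg _ _) rmorph_prod.
  by apply: eq_bigr => i _; rewrite rmorphXn.
by rewrite mulr_algr coefZ.
Qed.

(** * The space T inside the polynomial algebra *)

Section LinearExtension.
Variables (R : realType) (K : choiceType) (V : lmodType R) (h : K -> V).

Lemma lextE (p : malg K R) (d : {fset K}) : (msupp p `<=` d)%fset ->
  lext h p = \sum_(k <- d) mcoeff k p *: h k.
Proof.
move=> pd; rewrite lext.unlock (big_fset_incl _ pd) // => k _ /mcoeff_outdom ->.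
by rewrite scale0r.
Qed.

Lemma lext_linear : linear (lext h).
Proof.
move=> a p q; pose d := (msupp p `|` msupp q `|` msupp (a *: p + q))%fset.
have sub (X Y Z : {fset K}) (U := (X `|` Y `|` Z)%fset) :
    [/\ X `<=` U, Y `<=` U & Z `<=` U]%fset.
  by split; apply/fsubsetP => m mX; rewrite !inE mX ?orbT.
have [sp sq spq] := sub (msupp p) (msupp q) (msupp (a *: p + q)).
rewrite (lextE sp) (lextE sq) (lextE spq) scaler_sumr -big_split.
by apply: eq_bigr => m _; rewrite mcoeffD mcoeffZ scalerDl scalerA.
Qed.

HB.instance Definition _ :=
  GRing.isLinear.Build R (malg K R) V _ (lext h) lext_linear.

Lemma lextU k : lext h (mkmalgU k 1) = h k.
Proof. by rewrite (lextE msuppU_le) big_seq_fset1 mcoeffUU scale1r. Qed.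

End LinearExtension.

Section Bridge.
Variables (R : realType) (L : finType).
Local Notation zindex := (zindex L).
Local Notation Z := (poly zindex R).
Local Notation T := (malg (populated L) R).
Implicit Types (s : zindex) (p q : malg (cmonom zindex) R).

Lemma toP_zmon (b : cmonom zindex) : toP (zmon R b) = mono b 1.
Proof. by rewrite zmon.unlock mono.unlock. Qed.

Lemma toP_dvar s p : toP (dvar s p) = pder s (toP p).
Proof.
rewrite /dvar lext.unlock linear_sum pder.unlock psupp.unlock toPK.
apply: eq_bigr => m _; rewrite !linearZ /= toP_zmon coef.unlock toPK.
by rewrite -[in RHS](mulr1 (m s)%:R) monoZ.
Qed.

Definition zD_field s : Z := s.2.+1%:R *: mono (ucm ((s.1, s.2.+1) : zindex)) 1.

Definition zD : Z -> Z := vfield zD_field idfun.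

HB.instance Definition _ :=
  GRing.isLinear.Build R Z Z _ zD (vfield_linear zD_field).

Lemma zDM (x y : Z) : zD (x * y) = zD x * y + x * zD y.
Proof. exact: vfieldM. Qed.

Lemma toP_Dop p : toP (Dop p) = zD (toP p).
Proof.
have [d dp] := pder_fin (toP p).
have dp' s : s \notin d -> dvar s p = 0.
  by move=> /dp ps; apply: (can_inj (@toPK _ _)); rewrite toP_dvar ps linear0.
rewrite /Dop (fsbigTE d) => [|s /dp' ->]; last by rewrite mulr0 scaler0.
rewrite linear_sum /zD (vfieldE _ _ dp) //; apply: eq_bigr => s _ /=.
by rewrite linearZ /= toPM toP_dvar /zvar toP_zmon scalerAl.
Qed.

Lemma toP_iter_Dop k p : toP (iter k (@Dop R L) p) = iter k zD (toP p).
Proof. by elim: k => //= k IH; rewrite toP_Dop IH. Qed.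

Definition iota (v : T) : Z := toP (poly_of_T v).

Lemma iota_linear : linear iota.
Proof. by move=> a v w; rewrite /iota /poly_of_T !linearP. Qed.

HB.instance Definition _ := GRing.isLinear.Build R T Z _ iota iota_linear.

Lemma iotaU (b : populated L) : iota (mkmalgU b 1) = mono (val b) 1.
Proof. by rewrite /iota /poly_of_T lextU toP_zmon. Qed.

Lemma iotaE (v : T) : iota v = \sum_(b <- msupp v) mcoeff b v *: mono (val b) 1.
Proof.
rewrite /iota /poly_of_T lext.unlock linear_sum; apply: eq_bigr => b _.
by rewrite linearZ /= toP_zmon.
Qed.

Lemma coef_iota (b : populated L) (v : T) : coef (val b) (iota v) = mcoeff b v.
Proof.
rewrite iotaE coef_sum; under eq_bigr do rewrite coefZ coef_mono mulr_natr.
have [bv|bv] := boolP (b \in msupp v).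
  rewrite (big_fsetD1 _ bv) /= eqxx big1_fset ?addr0 // => k.
  by rewrite in_fsetD1 => /andP[/negbTE kb _] _; rewrite val_eqE kb.
rewrite (mcoeff_outdom bv) big1_fset // => k kv _.
by rewrite val_eqE; case: eqP => // kb; rewrite -kb kv in bv.
Qed.

(** ** The grading *)

Definition grade s : R := 1 - s.2%:R.

Lemma wt_grade (b : cmonom zindex) : wt grade b = (mbracket b)%:~R.
Proof.
rewrite /mbracket rmorph_sum; apply: eq_bigr => s _.
by rewrite rmorphM rmorphB /= mulr_natr.
Qed.

(** Homogeneity for the bracket, that is, two opposite filtrations. *)
Definition homog (v : R) (x : Z) := forall b, coef b x != 0 -> wt grade b = v.

Lemma wtN (om : zindex -> R) b : wt (fun s => - om s) b = - wt om b.
Proof. by rewrite -mulN1r -wtZ; apply: eq_bigr => s _; rewrite mulN1r. Qed.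

Lemma homogP v x :
  homog v x <-> filt grade v x /\ filt (fun s => - grade s) (- v) x.
Proof.
split=> [h|[h1 h2] b bx]; first by split=> b /h bv; rewrite ?wtN bv.
apply/eqP; rewrite eq_le h1 //=.
by have := h2 _ bx; rewrite wtN lerN2.
Qed.

Lemma homogM v v' x y : homog v x -> homog v' y -> homog (v + v') (x * y).
Proof.
move=> /homogP[x1 x2] /homogP[y1 y2]; apply/homogP; split; first exact: filtM.
by rewrite opprD; exact: filtM.
Qed.

Lemma homogD v x y : homog v x -> homog v y -> homog v (x + y).
Proof.
move=> /homogP[x1 x2] /homogP[y1 y2]; apply/homogP.
by split; apply: filtD.
Qed.

Lemma homogZ v a x : homog v x -> homog v (a *: x).
Proof. by move=> /homogP[x1 x2]; apply/homogP; split; apply: filtZ. Qed.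

Lemma homog_sum v (I : eqType) (r : seq I) (F : I -> Z) :
  (forall i, i \in r -> homog v (F i)) -> homog v (\sum_(i <- r) F i).
Proof. by move=> h; apply/homogP; split; apply: filt_sum => i /h /homogP[]. Qed.

Lemma homogX v x n : homog v x -> homog (v *+ n) (x ^+ n).
Proof.
move=> /homogP[x1 x2]; apply/homogP; split; first exact: filtX.
by rewrite -mulNrn; exact: filtX.
Qed.

Lemma homog_vfield d v (w : zindex -> Z) x :
  (forall s, homog (grade s + d) (w s)) -> homog v x ->
  homog (v + d) (vfield w idfun x).
Proof.
move=> wd /homogP[x1 x2]; apply/homogP; split.
  by apply: filt_vfield => // s; have /homogP[] := wd s.
rewrite opprD; apply: filt_vfield => // s.
by have /homogP[_] := wd s; rewrite opprD.
Qed.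

Lemma homog_morph (F : {lrmorphism Z -> Z}) v x :
  (forall s, homog (grade s) (F (mono (ucm s) 1))) -> homog v x -> homog v (F x).
Proof.
move=> Fg /homogP[x1 x2]; apply/homogP.
by split; [apply: filt_morph x1 => s|apply: filt_morph x2 => s];
   have /homogP[] := Fg s.
Qed.

Lemma homog_mono (b : cmonom zindex) a : homog (wt grade b) (mono b a).
Proof. by apply/homogP; split; apply: filt_mono; rewrite ?wtN. Qed.

Lemma homog_zD v x : homog v x -> homog (v - 1) (zD x).
Proof.
apply: homog_vfield => s; apply: homogZ.
have -> : grade s - 1 = wt grade (ucm ((s.1, s.2.+1) : zindex)).
  by rewrite wtU /grade /= -natr1 opprD addrA.
exact: homog_mono.
Qed.

Lemma homog_iter_zD k v x : homog v x -> homog (v - k%:R) (iter k zD x).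
Proof.
elim: k => [|k IH] vx; first by rewrite subr0.
by rewrite -natr1 opprD addrA /=; apply: homog_zD; exact: IH.
Qed.

Lemma wt_grade_populated (b : populated L) : wt grade (val b) = 1.
Proof. by rewrite wt_grade (eqP (valP b)). Qed.

Lemma homog_iota (v : T) : homog 1 (iota v).
Proof.
rewrite iotaE; apply: homog_sum => b _; apply: homogZ.
by rewrite -(wt_grade_populated b); exact: homog_mono.
Qed.

(** [T_of_poly] discards the monomials of bracket different from one, hence the
    homogeneity. *)
Lemma iota_T_of_poly p : homog 1 (toP p) -> iota (T_of_poly p) = toP p.
Proof.
move=> hp; rewrite /T_of_poly lext.unlock linear_sum [RHS]polyE psupp.unlock toPK.
rewrite big_seq [RHS]big_seq; apply: eq_bigr => m mp; rewrite linearZ /=.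
have cm : coef m (toP p) = mcoeff m p by rewrite coef.unlock toPK.
have m1 : mbracket m == 1.
  have := hp m; rewrite cm mcoeff_neq0 => /(_ mp); rewrite wt_grade => /eqP.
  by rewrite -[X in _ == X](mulr1z 1) eqr_int.
by rewrite insubT /= iotaU cm -[mcoeff m p in RHS]mulr1 monoZ.
Qed.

End Bridge.
Arguments zD {R L} _.

(** * Truncation by length *)

Section Truncation.
Variables (R : realType) (L : finType).
Local Notation zindex := (zindex L).
Local Notation Z := (poly zindex R).
Local Notation populated := (populated L).
Implicit Types (b : populated) (x y : Z) (f g : populated -> R).

Lemma mdeg_populated b : (0 < mdeg (val b))%N.
Proof.
rewrite lt0n mdeg_eq0; apply/eqP => b1.
have := wt_grade_populated R b; rewrite b1 [wt _ _]wt1 => /eqP.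
by rewrite eq_sym oner_eq0.
Qed.

(** [sum k b(l,k) = mdeg b - 1] bounds the second index of the letters, so that
    there are finitely many words of a given length. *)
Lemma populated_index b s : s \in finsupp (val b) -> (s.2 < mdeg (val b))%N.
Proof.
move=> sb; have := wt_grade_populated R b.
have -> : wt (@grade R L) (val b) =
    (mdeg (val b))%:R - (\sum_(s <- finsupp (val b)) s.2 * val b s)%N%:R.
  rewrite /wt mdegE !natr_sum -sumrB; apply: eq_bigr => i _.
  by rewrite mulrnBl natrM mulr_natr.
move/eqP; rewrite subr_eq nat1r eqr_nat => /eqP ->.
rewrite ltnS (big_fsetD1 _ sb) /=; apply: leq_trans (leq_addr _ _).
by rewrite leq_pmulr // lt0n cmE_neq0.
Qed.

(** A word of length at most [M] is listed by a sequence of at most [M] letters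
    with second index at most [M]. *)
Lemma finite_populated M :
  finite_set [set b : populated | (mdeg (val b) <= M)%N]%classic.
Proof.
have [->|/set0P[b0 _]] :=
  eqVneq [set b : populated | (mdeg (val b) <= M)%N]%classic classical_sets.set0.
  exact: finite_set0.
pose unwiden (s : L * 'I_M.+1) : zindex := (s.1, s.2 : nat).
pose h (w : M.-bseq (L * 'I_M.+1)) : populated :=
  insubd b0 (wordm (map unwiden w)).
apply: (sub_finite_set (B := (h @` [set: M.-bseq (L * 'I_M.+1)]%classic)%classic));
  last exact/finite_image/finite_finset.
move=> b /= bM.
pose w := map (fun s : zindex => (s.1, inord s.2 : 'I_M.+1)) (mlist (val b)).
have sw : (size w <= M)%N by rewrite size_map size_mlist.
exists (Bseq sw) => //; rewrite /h /=.
have -> : map unwiden w = mlist (val b).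
  rewrite -map_comp -[RHS]map_id; apply/eq_in_map => -[l n] /=.
  rewrite mem_mlist => /populated_index /= nb.
  by rewrite /unwiden /= inordK // ltnW // ltnS (leq_trans nb).
by rewrite wordm_mlist valKd.
Qed.

Definition popfset M : {fset populated} :=
  fset_set [set b : populated | (mdeg (val b) <= M)%N]%classic.

Lemma mem_popfset M b : (b \in popfset M) = (mdeg (val b) <= M)%N.
Proof.
rewrite in_fset_set; last exact: finite_populated.
by apply/idP/idP; rewrite inE.
Qed.

Definition trunc M g : Z := \sum_(b <- popfset M) g b *: mono (val b) 1.

Lemma coef_trunc M g b : (mdeg (val b) <= M)%N -> coef (val b) (trunc M g) = g b.
Proof.
rewrite -mem_popfset => bM; rewrite coef_sum.
under eq_bigr do rewrite coefZ coef_mono mulr_natr.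
rewrite (big_fsetD1 _ bM) /= eqxx big1_fset ?addr0 // => k.
by rewrite in_fsetD1 => /andP[/negbTE kb _] _; rewrite val_eqE kb.
Qed.

Lemma homog_trunc M g : homog 1 (trunc M g).
Proof.
apply: homog_sum => b _; apply: homogZ.
by rewrite -(wt_grade_populated R b); exact: homog_mono.
Qed.

(** Order of vanishing at least [n]: the signs turn a lower bound on the lengths
    into a filtration. *)
Definition order n x := filt (fun=> -1 : R) (- n%:R) x.

Lemma wt_order (m : cmonom zindex) : wt (fun=> -1 : R) m = - (mdeg m)%:R.
Proof. by rewrite -wt_mdeg -wtN. Qed.

Lemma orderP n x m : order n x -> (mdeg m < n)%N -> coef m x = 0.
Proof. by move=> nx mn; apply: (filtP nx); rewrite wt_order ltrN2 ltr_nat. Qed.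

Lemma order0 x : order 0 x.
Proof. by move=> m _; rewrite wt_order oppr0 oppr_le0. Qed.

Lemma order_mono m a : order (mdeg m) (mono m a).
Proof. by apply: filt_mono; rewrite wt_order. Qed.

Lemma orderM n n' x y : order n x -> order n' y -> order (n + n') (x * y).
Proof. by move=> nx ny; rewrite /order natrD opprD; exact: filtM. Qed.

Lemma order_zD n x : order n x -> order n (zD x).
Proof.
move=> nx; rewrite /order -[- n%:R]addr0; apply: filt_vfield => // s.
by rewrite addr0; apply: filtZ; apply: filt_mono; rewrite wtU.
Qed.

Lemma order_iter_zD n k x : order n x -> order n (iter k zD x).
Proof. by move=> nx; elim: k => //= k; exact: order_zD. Qed.

End Truncation.

(** * The exponential of (T, D) *)

Section ExpD.
Variables (R : realType) (L : finType).
Local Notation zindex := (zindex L).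
Local Notation Z := (poly zindex R).
Local Notation T := (malg (populated L) R).
Local Notation populated := (populated L).
Variables (UT : guin_oudom (@Dprod R L)) (rhoD : env_rep UT (@Dprod R L)).
Implicit Types (b : populated) (x y p : Z) (f g : populated -> R).

Lemma iota_Dprod (u v : T) : iota (Dprod u v) = iota u * zD (iota v).
Proof.
have E : toP (poly_of_T u * Dop (poly_of_T v)) = iota u * zD (iota v).
  by rewrite toPM toP_Dop.
rewrite /Dprod iota_T_of_poly ?E //.
have -> : 1 = 1 + (1 - 1) :> R by rewrite subrr addr0.
by apply: homogM; [|apply: homog_zD]; exact: homog_iota.
Qed.

(** The action of [u] is [iota u * zD _], so this keeps [iota u] on the left. *)
Definition opD (u : T) (O : Z -> Z) x : Z := iota u * O (zD x).

Definition expD M x y : Z :=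
  \sum_(n < M.+1) n`!%:R^-1 *: (x ^+ n * iter n zD y).

Lemma expD_linear M x : linear (expD M x).
Proof.
have iterD n : linear (iter n (@zD R L)).
  by elim: n => [//|n IH a y z]; rewrite [LHS]/= IH linearP.
move=> a y z; rewrite /expD scaler_sumr -big_split; apply: eq_bigr => n _ /=.
rewrite iterD mulrDr scalerDr -scalerAr !scalerA.
by rewrite [a * _]mulrC.
Qed.

HB.instance Definition _ M x :=
  GRing.isLinear.Build R Z Z _ (expD M x) (expD_linear M x).

Lemma expDZ M x a y : expD M x (a *: y) = a *: expD M x y.
Proof. exact: linearZ. Qed.

Lemma expD_sum M x (I : Type) (r : seq I) (F : I -> Z) :
  expD M x (\sum_(i <- r) F i) = \sum_(i <- r) expD M x (F i).
Proof. exact: linear_sum. Qed.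

Lemma order_expD M n x y : order n y -> order n (expD M x y).
Proof.
move=> ny; apply: filt_sum => k _; apply: filtZ.
rewrite -[n]add0n; apply: orderM; first exact: order0.
exact: order_iter_zD.
Qed.

Lemma homog_expD M x y : homog 1 x -> homog 1 y -> homog 1 (expD M x y).
Proof.
move=> hx hy; apply: homog_sum => n _; apply: homogZ.
have -> : 1 = 1 *+ n + (1 - n%:R) :> R by rewrite addrC subrK.
by apply: homogM; [exact: homogX|exact: homog_iter_zD].
Qed.

Lemma opD_word_order w v p : order v p ->
  order (\sum_(b <- w) mdeg (val b) + v) (word_op opD w p).
Proof.
elim/last_ind: w v p => [|w b IH] v p vp; first by rewrite big_nil.
rewrite /word_op foldl_rcons -/(word_op opD w) /opD -cats1 big_cat big_seq1 /=.
rewrite [(_ + mdeg (val b))%N]addnC -addnA iotaU; apply: orderM.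
  exact: order_mono.
by apply: IH; exact: order_zD.
Qed.

Section Theta.
Variable M : nat.

Definition ThetaD n p : poly populated Z :=
  expser (popfset L M) (fun b => mono (val b) 1 : Z) n
    (fun i => i`!%:R^-1 *: iter i zD p).

Lemma ThetaD_const n p : coef (onecm populated) (ThetaD n p) = p.
Proof. by rewrite coef_expser_const fact0 invr1 scale1r. Qed.

Lemma ThetaD_pder b n p (ev : {scalar poly populated Z}) : b \in popfset L M ->
  opD (mkmalgU b 1) (fun q => ev (ThetaD n q)) p = ev (pder b (ThetaD n.+1 p)).
Proof.
move=> bM; rewrite /opD iotaU pder_expser //; congr (_ * ev _).
apply: eq_expser => i; rewrite -iterSr mulr_natl -scaler_nat scalerA.
congr (_ *: _); rewrite factS natrM invfM mulrA divff ?mul1r //.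
Qed.

Lemma psubst_ThetaD n p (f : populated -> R) :
  psubst idfun (fun b => (f b)%:A) (ThetaD n p) =
  expD n (\sum_(b <- popfset L M) f b *: mono (val b) 1) p.
Proof.
rewrite psubst_expser; apply: eq_bigr => i _.
rewrite -scalerAl mulrC; congr (_ *: (_ ^+ _ * _)).
by apply: eq_bigr => b _; rewrite mulr_algr.
Qed.

End Theta.

Lemma opD_ext a (O O' : Z -> Z) : O =1 O' -> opD a O =1 opD a O'.
Proof. by move=> e x; rewrite /opD e. Qed.

Lemma opD_lin a c (O O' : Z -> Z) p : linear O -> linear O' ->
  opD a (fun q => c *: O q + O' q) p = c *: opD a O p + opD a O' p.
Proof. by move=> _ _; rewrite /opD mulrDr scalerAr. Qed.

Lemma opD_linear a : linear (opD a idfun).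
Proof. by move=> c p q; rewrite /opD linearP mulrDr scalerAr. Qed.

Lemma opD_pre a a' (O : Z -> Z) p : linear O ->
  opD a' idfun (opD a O p) =
  opD a (fun q => opD a' idfun (O q)) p + opD (Dprod a' a) O p.
Proof.
move=> _; rewrite /opD zDM iota_Dprod mulrDr addrC mulrCA; congr (_ + _).
exact: mulrA.
Qed.

(** The coefficients of [rho (A_m)] on words of length at most [M] only see the
    factors of length at most [M], and at most [M] of them: each factor
    lengthens the word. *)
Lemma rhoD_go_basis_long M m b k : (mdeg (val b) <= M)%N ->
  ~~ (all (mem (popfset L M)) (mlist m) && (mdeg m <= M)%N) ->
  mcoeff b (rhoD (go_basis UT m) (mkmalgU k 1)) = 0.
Proof.
move=> bM long; rewrite -coef_iota.
rewrite (rho_go_basis rhoD (@iota_linear R L) opD_ext opD_lin opD_linear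
  iota_Dprod opD_pre).
rewrite coefZ (orderP (opD_word_order (@order0 R L _))) ?mulr0 // addn0.
apply: leq_ltn_trans bM _; move: long; rewrite negb_and -has_predC -ltnNge.
case/orP => [/hasP[i im iX]|Mm].
  have {iX} : i \notin popfset L M by exact: iX.
  rewrite (mem_popfset R) -ltnNge => /leq_trans; apply.
  by rewrite (big_rem i) //= leq_addr.
apply: leq_trans Mm _; rewrite -size_mlist -sum1_size.
by apply: leq_sum => i _; exact: mdeg_populated.
Qed.

Lemma exp_coeffD M f b k : (mdeg (val b) <= M)%N ->
  exp_coeff rhoD f b k = coef (val b) (expD M (trunc M f) (mono (val k) 1)).
Proof.
(* The generating function only has the variables in [popfset L M]. Cutting [f]
   off makes the other words contribute zero on both sides. *)
move=> bM; pose fM b := if b \in popfset L M then f b else 0.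
rewrite (exp_coeff_psubst (g := fM) (m0 := val b) (F := ThetaD M M (mono (val k) 1))).
  rewrite psubst_ThetaD; congr (coef _ (expD _ _ _)).
  rewrite big_seq [RHS]big_seq; apply: eq_bigr => i iM.
  by rewrite /fM iM.
move=> m; have [/andP[mX mM]|long] :=
  boolP (all (mem (popfset L M)) (mlist m) && (mdeg m <= M)%N).
  have -> : mpow f m = mpow fM m.
    rewrite /mpow big_seq [RHS]big_seq; apply: eq_bigr => i im.
    have iX : i \in popfset L M by apply: (allP mX); rewrite mem_mlist.
    by rewrite /fM iX.
  congr (_ * _); rewrite -coef_iota; congr coef.
  have := @rho_go_basisE R populated populated zindex _ UT _ rhoD _ _
    (@iota_linear R L) opD_ext opD_lin opD_linear iota_Dprod opD_pre
    (mem (popfset L M)) (ThetaD M) (ThetaD_const M) (@ThetaD_pder M)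
    m (M - mdeg m)%N (mkmalgU k 1) mX.
  by rewrite iotaU subnKC.
rewrite (rhoD_go_basis_long _ bM long) mulr0.
move: long; rewrite negb_and -has_predC -ltnNge => /orP[/hasP[i]|Mm].
  rewrite mem_mlist => im iX.
  have {}iX : (i \in popfset L M) = false by exact: negbTE iX.
  rewrite /mpow (big_fsetD1 _ im) /= /fM iX expr0n.
  by move: im; rewrite -cmE_neq0 => /negbTE ->; rewrite !mul0r.
by rewrite coef_expser_big // linear0 mulr0.
Qed.

(** By [normal_star], [rho (A_I)] is [z^(sum I) D^(length I) / I!], and summing
    over [I] gives [\sum_n f^n D^n / n!]. As neither factor shortens words,
    truncating at length [M] does not change this coefficient. *)
Lemma exp_actD M f g b : (mdeg (val b) <= M)%N ->
  exp_act rhoD f g b = coef (val b) (expD M (trunc M f) (trunc M g)).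
Proof.
move=> bM; rewrite /exp_act (fsbigTE (popfset L M)) => [|k].
  rewrite [trunc M g]/trunc expD_sum coef_sum; apply: eq_bigr => k _.
  by rewrite expDZ coefZ (exp_coeffD _ _ bM) mulrC.
rewrite (mem_popfset R) -ltnNge => Mk; rewrite (exp_coeffD _ _ bM).
rewrite (orderP (@order_expD M _ _ _ (@order_mono R L _ _))) ?mul0r //.
exact: leq_ltn_trans bM Mk.
Qed.

End ExpD.

(** * The exponential of the translation pre-Lie algebra *)

Lemma poly_rmorph_eq (I : choiceType) (A S : comNzRingType)
    (F G : {rmorphism poly I A -> S}) :
  (forall a, F a%:A = G a%:A) ->
  (forall i, F (mono (ucm i) 1) = G (mono (ucm i) 1)) -> F =1 G.
Proof.
move=> FGc FGv; elim/poly_ind => [|i p IH|a p q IHp IHq].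
- by rewrite !rmorph1.
- by rewrite !rmorphM FGv IH.
- by rewrite !rmorphD -[a *: p]mulr_algl !rmorphM FGc IHp IHq.
Qed.

Section Translation.
Variables (R : realType) (L : finType).
Local Notation zindex := (zindex L).
Local Notation Z := (poly zindex R).
Local Notation T := (malg (populated L) R).
Local Notation rindex := (rindex L).
Local Notation A := (malg rindex R).
Local Notation zv l k := (mono (ucm ((l, k) : zindex)) 1 : Z).
Implicit Types (s : zindex) (l : L) (c : A) (x y : Z) (r : rindex).

(** The polynomial [c_l] such that [c] acts by
    [\sum_(l, k) (D^k c_l / k!) d/dz_(l,k)]. *)
Definition tcomp l : A -> Z :=
  lext (fun r => if r.2 == l then mono (val r.1) 1 else 0).

Definition tfield c s : Z := s.2`!%:R^-1 *: iter s.2 zD (tcomp s.1 c).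

Lemma iter_zD_linear n : linear (iter n (@zD R L)).
Proof. by elim: n => [//|n IH a y z]; rewrite [LHS]/= IH linearP. Qed.

HB.instance Definition _ n :=
  GRing.isLinear.Build R Z Z _ (iter n (@zD R L)) (iter_zD_linear n).

Lemma tfieldE c s :
  tfield c s = \sum_(r <- msupp c) mcoeff r c *: tfield (mkmalgU r 1) s.
Proof.
rewrite /tfield {1}/tcomp lext.unlock linear_sum scaler_sumr.
apply: eq_bigr => r _; rewrite linearZ /= scalerA mulrC -scalerA.
by rewrite /tcomp lextU.
Qed.

Lemma zD_var l k : zD (zv l k) = k.+1%:R *: zv l k.+1.
Proof. exact: vfield_var. Qed.

(** The coefficients [D^k c_l / k!] are the prolongation that makes the vector
    field, and the substitution, commute with [D]. *)
Lemma tfield_prolong c l k :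
  k.+1%:R *: tfield c (l, k.+1) = zD (tfield c (l, k)).
Proof.
rewrite /tfield [zD _]linearZ /= scalerA factS natrM invfM mulrA.
by rewrite divff ?mul1r // pnatr_eq0.
Qed.

Definition tder c : Z -> Z := vfield (tfield c) idfun.

HB.instance Definition _ c :=
  GRing.isLinear.Build R Z Z _ (tder c) (vfield_linear (tfield c)).

Lemma tderM c x y : tder c (x * y) = tder c x * y + x * tder c y.
Proof. exact: vfieldM. Qed.

Lemma tder_var c s : tder c (mono (ucm s) 1) = tfield c s.
Proof. exact: vfield_var. Qed.

(** The commutator of two derivations is a derivation, so it suffices that it
    vanishes on the variables, where it does by [tfield_prolong]. *)
Lemma tder_zD c x : tder c (zD x) = zD (tder c x).
Proof.
elim/poly_ind: x => [|[l k] x IH|a x y IHx IHy].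
- have D1 : zD 1 = 0 :> Z by exact: vfield1.
  have V1 : tder c 1 = 0 by exact: vfield1.
  by rewrite D1 V1 !linear0.
- rewrite zDM tderM zD_var [tder c (_ + _)]linearD [zD (_ + _)]linearD /=.
  rewrite !tderM !zDM zD_var tder_var IH [tder c (_ *: _)]linearZ /= tder_var.
  by rewrite tfield_prolong -!addrA; congr (_ + _); rewrite addrCA.
- by rewrite !linearP /= IHx IHy.
Qed.

Lemma tder_iter_zD c n x : tder c (iter n zD x) = iter n zD (tder c x).
Proof. by elim: n => //= n IH; rewrite tder_zD IH. Qed.

Definition opR c (O : Z -> Z) x : Z := vfield (tfield c) O x.

Lemma homog_tcomp c l : homog 1 (tcomp l c).
Proof.
rewrite /tcomp lext.unlock; apply: homog_sum => r _; apply: homogZ.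
case: eqP => _; last by move=> b; rewrite linear0 eqxx.
by rewrite -(wt_grade_populated R r.1); exact: homog_mono.
Qed.

Lemma homog_tfield c s : homog (grade R s) (tfield c s).
Proof. by apply: homogZ; apply: homog_iter_zD; exact: homog_tcomp. Qed.

Lemma homog_tder c v x : homog v x -> homog v (tder c x).
Proof.
rewrite -[v]addr0 => vx; apply: homog_vfield; last by rewrite addr0 in vx.
by move=> s; rewrite addr0; exact: homog_tfield.
Qed.

Lemma toP_rho_sym r (p : T) :
  toP (\sum_(k \in [set: nat])
    (k`!%:R^-1 *: iter k (@Dop R L) (zmon R (val r.1))) *
      dvar (r.2, k) (poly_of_T p)) = tder (mkmalgU r 1) (iota p).
Proof.
have [d dp] := pder_fin (iota p).
pose K := [fset s.2 | s in d]%fset.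
have offK k : k \notin K -> pder ((r.2, k) : zindex) (iota p) = 0.
  by move=> kK; apply: dp; apply: contra kK => kd; apply/imfsetP; exists (r.2, k).
rewrite (fsbigTE K) => [|k /offK pk]; last first.
  rewrite (_ : dvar _ _ = 0) ?mulr0 //.
  by apply: (can_inj (@toPK _ _)); rewrite toP_dvar pk linear0.
rewrite /tder /vfield (fsbigTE [fset ((r.2, k) : zindex) | k in K]%fset); last first.
  move=> [l k] lk; have [rl|rl] := eqVneq r.2 l; last first.
    rewrite /tfield /tcomp lextU /= (negbTE rl) linear0 scaler0.
    exact: mul0r.
  rewrite (_ : pder _ _ = 0) ?mulr0 // -rl; apply: offK.
  by apply: contra lk => kK; apply/imfsetP; exists k; rewrite // rl.
rewrite [RHS]big_imfset /=; last by move=> k k' _ _ [->].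
rewrite linear_sum; apply: eq_bigr => k _.
rewrite /= toPM linearZ /= toP_iter_Dop toP_zmon toP_dvar.
by rewrite /tfield /= /tcomp lextU eqxx.
Qed.

Lemma iota_rho_tilde c (p : T) : iota (rho_tilde c p) = tder c (iota p).
Proof.
rewrite /rho_tilde lext.unlock linear_sum.
have [d dp] := pder_fin (iota p).
rewrite /tder (vfieldE _ _ dp) //.
under eq_bigr => r _.
  rewrite linearZ /= /rho_sym iota_T_of_poly; last first.
    by rewrite toP_rho_sym; apply: homog_tder; exact: homog_iota.
  rewrite toP_rho_sym /tder (vfieldE _ _ dp) // scaler_sumr.
  over.
rewrite exchange_big; apply: eq_bigr => s _ /=.
rewrite tfieldE mulr_suml; apply: eq_bigr => r _.
exact: scalerAl.
Qed.

Lemma tcomp_Rprod a c l : tcomp l (Rprod a c) = tder a (tcomp l c).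
Proof.
have lextS (K : choiceType) (V : lmodType R) (h : K -> V) (p : malg K R) :
  lext h p = \sum_(k <- msupp p) mcoeff k p *: h k by exact/lextE/fsubset_refl.
rewrite /Rprod [lext _ c]lextS /tcomp [lext _ c]lextS !linear_sum.
apply: eq_bigr => r _; rewrite /= !linearZ /=; congr (_ *: _).
rewrite [lext _ (rho_tilde _ _)]lextS linear_sum /=.
under eq_bigr do rewrite linearZ /= lextU /=.
case: eqP => _; last by rewrite linear0 big1 // => b _; rewrite scaler0.
by rewrite -iotaE iota_rho_tilde iotaU.
Qed.

(** The components of a product are the derivatives of the components, because
    fields of this form commute with [D]. This is the compatibility that
    [normal_star] asks for. *)
Lemma tfield_Rprod a c s : tfield (Rprod a c) s = tder a (tfield c s).
Proof. by rewrite /tfield tcomp_Rprod [RHS]linearZ /= tder_iter_zD. Qed.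

Lemma opR_ext c (O O' : Z -> Z) : O =1 O' -> opR c O =1 opR c O'.
Proof. by move=> e x; exact: eq_vfield. Qed.

Let lin0 (O : Z -> Z) : linear O -> O 0 = 0.
Proof.
by move=> lO; have := lO (-1) 0 0; rewrite scaleN1r oppr0 addr0 scaleN1r addNr.
Qed.

Lemma opR_lin c a (O O' : Z -> Z) x : linear O -> linear O' ->
  opR c (fun y => a *: O y + O' y) x = a *: opR c O x + opR c O' x.
Proof.
move=> /lin0 O0 /lin0 O'0; have [d dx] := pder_fin x.
rewrite /opR !(vfieldE _ _ dx) ?O0 ?O'0 ?scaler0 ?addr0 //.
rewrite scaler_sumr -big_split; apply: eq_bigr => s _ /=.
by rewrite mulrDr scalerAr.
Qed.

Lemma opR_pre a a' (O : Z -> Z) x : linear O ->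
  opR a' idfun (opR a O x) =
  opR a (fun y => opR a' idfun (O y)) x + opR (Rprod a' a) O x.
Proof.
move=> /lin0 O0; rewrite /opR vfield_comp //; congr (_ + _).
by apply: eq_vfieldl => s; rewrite tfield_Rprod.
Qed.

(** ** The substitution z_s -> z_s + tfield c s *)

Definition trans_subst c : {rmorphism Z -> Z} :=
  psubst (in_alg Z) (fun s => mono (ucm s) 1 + tfield c s).

Definition trans c : Z -> Z := trans_subst c.

HB.instance Definition _ c := GRing.RMorphism.copy (trans c) (trans_subst c).

Lemma trans_scalable c : scalable (trans c).
Proof.
by move=> a x; rewrite -[a *: x]mulr_algl rmorphM /trans /= psubstC mulr_algl.
Qed.

HB.instance Definition _ c :=
  GRing.isScalable.Build R Z Z *:%R (trans c) (trans_scalable c).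

Lemma trans_var c s : trans c (mono (ucm s) 1) = mono (ucm s) 1 + tfield c s.
Proof. exact: psubst_var. Qed.

(** Since [D] is a derivation and [trans c] a morphism, it suffices to compare
    both sides on the variables. *)
Lemma trans_zD c x : trans c (zD x) = zD (trans c x).
Proof.
elim/poly_ind: x => [|[l k] x IH|a x y IHx IHy].
- have D1 : zD 1 = 0 :> Z by exact: vfield1.
  by rewrite D1 rmorph1 D1 linear0.
- rewrite zDM rmorphD !rmorphM zDM /= IH zD_var linearZ /= !trans_var.
  by rewrite [zD (_ + _)]linearD /= zD_var scalerDr tfield_prolong.
- have zDl : linear (@zD R L) by exact: linearP.
  have trl : linear (trans c) by exact: linearP.
  by rewrite zDl !trl zDl IHx IHy.
Qed.

Lemma trans_iter_zD c n x : trans c (iter n zD x) = iter n zD (trans c x).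
Proof. by elim: n => //= n IH; rewrite trans_zD IH. Qed.

Lemma trans_expD c M x y : trans c (expD M x y) = expD M (trans c x) (trans c y).
Proof.
rewrite /expD linear_sum; apply: eq_bigr => n _ /=.
by rewrite linearZ rmorphM rmorphXn /= trans_iter_zD.
Qed.

Lemma homog_trans c v x : homog v x -> homog v (trans c x).
Proof.
apply: homog_morph => s; rewrite /= trans_var; apply: homogD.
  by rewrite -(wtU (@grade R L) s); exact: homog_mono.
exact: homog_tfield.
Qed.

Lemma filt_tfield (om : L -> R) v c s :
  (forall r, r \in msupp c -> r.2 = s.1 -> wt (fun s => om s.1) (val r.1) <= v) ->
  filt (fun s => om s.1) v (tfield c s).
Proof.
move=> cv; apply: filtZ; elim: (s.2) => [|n IH] /=.
  rewrite /tcomp lext.unlock; apply: filt_sum => r rc; apply: filtZ.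
  by case: eqP => [rs|_]; [apply: filt_mono; exact: cv|exact: filt0].
rewrite -[v]addr0; apply: filt_vfield => // i.
by apply: filtZ; apply: filt_mono; rewrite wtU addr0.
Qed.

(** The components have no constant term, because populated words are not
    empty. *)
Lemma order_tfield c s : order 1 (tfield c s).
Proof.
apply: (@filt_tfield (fun=> -1)) => r _ _.
by rewrite wt_order lerN2 ler_nat (mdeg_populated R).
Qed.

Lemma order_trans c n x : order n x -> order n (trans c x).
Proof.
apply: filt_morph => s; rewrite /= trans_var; apply: filtD.
  by apply: filt_mono; rewrite wtU.
exact: order_tfield.
Qed.

Variables (UR : guin_oudom (@Rprod R L)) (rhoR : env_rep UR (@rho_tilde R L)).
Implicit Types (b k : populated L) (g : populated L -> R).

(** Taylor's formula: the normally ordered exponential of a vector field is the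
    substitution which adds to each variable its component. *)
Lemma exp_coeffR c b k :
  exp_coeff rhoR (fun r => mcoeff r c) b k =
  coef (val b) (trans c (mono (val k) 1)).
Proof.
pose Xc := msupp c.
pose W (r : rindex) s : Z := tfield (mkmalgU r 1) s.
pose Th := shift (@idfun Z) Xc W.
rewrite (exp_coeff_psubst (g := fun r => mcoeff r c) (m0 := val b)
  (F := Th (mono (val k) 1))).
  rewrite psubst_shift; congr coef; move: (mono _ _).
  apply: poly_rmorph_eq => [a|s]; first by rewrite psubstC [RHS]psubstC.
  rewrite psubst_var /= trans_var tfieldE; congr (_ + _).
  by apply: eq_bigr => r _; rewrite mulr_algr.
move=> m; have [mX|] := boolP (all (mem Xc) (mlist m)).
  congr (_ * _); rewrite -coef_iota; congr coef.
  have := @rho_go_basisE R rindex (populated L) zindex _ UR _ rhoR _ _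
    (@iota_linear R L) opR_ext
    opR_lin (fun c => vfield_linear (tfield c))
    iota_rho_tilde opR_pre (mem Xc) (fun=> Th) _ _ m 0%N (mkmalgU k 1) mX.
  rewrite iotaU; apply.
    by move=> n p; rewrite coef_shift_const.
  by move=> r n p ev rX; rewrite pder_shift.
rewrite -has_predC => /hasP[r]; rewrite mem_mlist => rm rX.
have {}rX : mcoeff r c = 0 by apply: mcoeff_outdom; exact: rX.
rewrite /mpow (big_fsetD1 _ rm) /= rX expr0n.
by move: rm; rewrite -cmE_neq0 => /negbTE ->; rewrite !mul0r.
Qed.

Lemma exp_actR c g b M : (mdeg (val b) <= M)%N ->
  exp_act rhoR (fun r => mcoeff r c) g b = coef (val b) (trans c (trunc M g)).
Proof.
move=> bM; rewrite /exp_act (fsbigTE (popfset L M)) => [|k].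
  rewrite [trunc M g]/trunc linear_sum coef_sum; apply: eq_bigr => k _.
  by rewrite exp_coeffR linearZ coefZ mulrC.
rewrite (mem_popfset R) -ltnNge => Mk; rewrite exp_coeffR.
rewrite (orderP (@order_trans c _ _ (@order_mono R L _ _))) ?mul0r //.
exact: leq_ltn_trans bM Mk.
Qed.

End Translation.

(** * Chen's relation *)

Section Chen.
Variables (R : realType) (L : finType).
Local Notation zindex := (zindex L).
Local Notation Z := (poly zindex R).
Local Notation populated := (populated L).
Variables (UT : guin_oudom (@Dprod R L)) (rhoD : env_rep UT (@Dprod R L)).
Variables (UR : guin_oudom (@Rprod R L)) (rhoR : env_rep UR (@rho_tilde R L)).
Implicit Types (b : populated) (x y : Z) (f g : populated -> R).

(** Formal series are compared through polynomials modulo order [M.+1]; these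
    two lemmas pass from coefficients to congruences and back. *)
Lemma order_eq M x y : homog 1 x -> homog 1 y ->
  (forall b, (mdeg (val b) <= M)%N -> coef (val b) x = coef (val b) y) ->
  order M.+1 (x - y).
Proof.
move=> hx hy xy m mxy; rewrite wt_order lerN2 ler_nat ltnNge.
apply: contraNN mxy => mM.
have [m1|m1] := boolP (mbracket m == 1).
  have -> : m = val (exist _ m m1 : populated) by [].
  by rewrite coefB xy ?subrr.
have c0 z : homog 1 z -> coef m z = 0.
  move=> hz; apply/eqP; apply: contraNT m1 => /hz; rewrite wt_grade => /eqP.
  by rewrite -[X in _ == X](mulr1z 1) eqr_int.
by rewrite coefB !c0 ?subrr.
Qed.

Lemma coef_order_eq M x y m : order M.+1 (x - y) -> (mdeg m <= M)%N ->
  coef m x = coef m y.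
Proof.
move=> xy mM; apply/eqP; rewrite -subr_eq0 -coefB; apply/eqP.
exact: (orderP xy).
Qed.

Lemma order_mull n x y : order n y -> order n (x * y).
Proof. by move=> ny; rewrite -[n]add0n; apply: orderM => //; exact: order0. Qed.

Lemma order_expD_congr M n x x' y y' : order n (x - x') -> order n (y - y') ->
  order n (expD M x y - expD M x' y').
Proof.
move=> xx' yy'; rewrite /expD -sumrB; apply: filt_sum => k _.
rewrite -scalerBr; apply: filtZ.
have -> : x ^+ k * iter k zD y - x' ^+ k * iter k zD y' =
    x ^+ k * iter k zD (y - y') + iter k zD y' * (x ^+ k - x' ^+ k).
  rewrite [iter k zD (y - y')]linearB /= mulrBr mulrBr addrA.
  by rewrite [iter k zD y' * x ^+ k]mulrC subrK [iter k zD y' * _]mulrC.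
apply: filtD; first by apply: order_mull; exact: order_iter_zD.
by rewrite subrXX mulrA mulrAC; apply: order_mull; rewrite -?mulrA.
Qed.

(** Apply the morphism to Chen's relation for [x]. It commutes with products and
    with [D], hence with [\sum_n f^n D^n g / n!]; and it does not lower the
    order, so each series may be replaced by its truncation. *)
Lemma chen_translate c (xst xsu xut : populated -> R) :
  let tr g := exp_act rhoR (fun r => mcoeff r c) g in
  (forall b, xst b = xsu b + exp_act rhoD xsu xut b) ->
  forall b, tr xst b = tr xsu b + exp_act rhoD (tr xsu) (tr xut) b.
Proof.
move=> tr chen b; pose M := mdeg (val b).
have trE g : order M.+1 (trans c (trunc M g) - trunc M (tr g)).
  apply: order_eq => [||b' b'M]; first by apply: homog_trans; exact: homog_trunc.
    exact: homog_trunc.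
  by rewrite coef_trunc // /tr (exp_actR _ _ _ b'M).
have xE : order M.+1 (trunc M xst - (trunc M xsu + expD M (trunc M xsu) (trunc M xut))).
  apply: order_eq => [||b' b'M]; first exact: homog_trunc.
    by apply: homogD; [|apply: homog_expD]; exact: homog_trunc.
  by rewrite coefD !coef_trunc // chen (exp_actD rhoD _ _ b'M).
rewrite /tr !(exp_actR rhoR _ _ (leqnn M)) (exp_actD rhoD _ _ (leqnn M)).
have /coef_order_eq -> // : order M.+1 (trans c (trunc M xst) -
    trans c (trunc M xsu + expD M (trunc M xsu) (trunc M xut))).
  by rewrite -[_ - _]linearB; exact: order_trans.
rewrite [trans c (_ + _)]linearD /= coefD trans_expD; congr (_ + _).
by apply: (coef_order_eq _ (leqnn M)); apply: order_expD_congr; exact: trE.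
Qed.

End Chen.

(** * Hoelder bounds *)

Section Hoelder.
Variable R : realType.
Implicit Types (w : R) (f : R -> R -> R).

Lemma holder_boundP w f : holder_bound w f <->
  exists C, forall s t, 0 <= s -> s < t -> t <= 1 -> `|f s t| <= C * powR `|t - s| w.
Proof.
have pos s t : s < t -> 0 < powR `|t - s| w.
  by move=> st; apply: powR_gt0; rewrite normr_gt0 subr_eq0 gt_eqF.
rewrite /holder_bound; set S := (X in ereal_sup X); split=> [|[C fC]].
  have ubS s t : 0 <= s -> s < t -> t <= 1 ->
      ((`|f s t| / powR `|t - s| w)%:E <= ereal_sup S)%E.
    by move=> s0 st t1; apply: ereal_sup_ubound; exists s, t.
  case: (ereal_sup S) ubS => [C| |] ubS // _; last first.
    by have := ubS 0 1 (lexx _) ltr01 (lexx _).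
  exists C => s t s0 st t1; rewrite -ler_pdivrMr ?pos //.
  by have := ubS s t s0 st t1; rewrite lee_fin.
apply: (@Order.POrderTheory.le_lt_trans _ _ C%:E); last exact: ltry.
apply: ge_ereal_sup => _ [s [t [s0 st t1 ->]]].
by rewrite lee_fin ler_pdivrMr ?pos // fC.
Qed.

Lemma holder_le w w' f : w' <= w -> holder_bound w f -> holder_bound w' f.
Proof.
move=> ww' /holder_boundP[C fC]; apply/holder_boundP; exists `|C| => s t s0 st t1.
apply: le_trans (fC s t s0 st t1) _.
apply: (@le_trans _ _ (`|C| * powR `|t - s| w)).
  by rewrite ler_wpM2r ?powR_ge0 ?ler_norm.
rewrite ler_wpM2l ?normr_ge0 //; apply: ger_powR ww'.
have ts0 : 0 < t - s by rewrite subr_gt0.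
rewrite gtr0_norm // ts0 /= lerBlDr; apply: le_trans t1 _.
by rewrite lerDl.
Qed.

Lemma eq_holder w f g :
  (forall s t, 0 <= s -> s < t -> t <= 1 -> f s t = g s t) ->
  holder_bound w g -> holder_bound w f.
Proof.
move=> fg /holder_boundP[C gC]; apply/holder_boundP; exists C => s t s0 st t1.
by rewrite fg //; exact: gC.
Qed.

Lemma holder_sum w (I : eqType) (r : seq I) (F : I -> R -> R -> R) :
  (forall i, i \in r -> holder_bound w (F i)) ->
  holder_bound w (fun s t => \sum_(i <- r) F i s t).
Proof.
elim: r => [|i r IH] Fw.
  apply/holder_boundP; exists 0 => s t _ _ _.
  by rewrite big_nil normr0 mul0r.
have /holder_boundP[C FC] := Fw i (mem_head _ _).
have /holder_boundP[C' FC'] : holder_bound w (fun s t => \sum_(i <- r) F i s t).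
  by apply: IH => j jr; apply: Fw; rewrite inE jr orbT.
apply/holder_boundP; exists (C + C') => s t s0 st t1.
rewrite big_cons mulrDl; apply: le_trans (ler_normD _ _) _.
by apply: lerD; [exact: FC|exact: FC'].
Qed.

Lemma holder_scale w a f : holder_bound w f -> holder_bound w (fun s t => a * f s t).
Proof.
move=> /holder_boundP[C fC]; apply/holder_boundP; exists (`|a| * C) => s t s0 st t1.
by rewrite normrM -mulrA ler_wpM2l // fC.
Qed.

End Hoelder.

Section TranslateHoelder.
Variables (R : realType) (L : finType).
Local Notation zindex := (zindex L).
Variables (UR : guin_oudom (@Rprod R L)) (rhoR : env_rep UR (@rho_tilde R L)).
Variables (x : R -> R -> populated L -> R) (c : malg (rindex L) R).

Lemma wt_const (I : choiceType) (th : R) (m : cmonom I) :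
  wt (fun=> th) m = th * (mdeg m)%:R.
Proof. by rewrite -wt_mdeg -wtZ; apply: eq_bigr => i _; rewrite mulr1. Qed.

(** A letter of exponent [om l] is replaced by words [r] with
    [th * length r <= om l]. Exponents and lengths add up, so a word [b] occurring
    in the image of [z^k] has [th * length b] at most the exponent of [k]. As [|t - s| <= 1], the
    bound for [x_k] implies the required one. *)
Lemma holder_translate (om : L -> R) (th : R) :
  (forall b, holder_bound (wt (fun s : zindex => om s.1) (val b))
    (fun s t => x s t b)) ->
  (forall l, th <= om l) ->
  (forall r, r \in msupp c -> th * (mdeg (val r.1))%:R <= om r.2) ->
  forall b, holder_bound (th * (mdeg (val b))%:R) (fun s t => translate rhoR c x s t b).
Proof.
move=> hx th_le c_le b.
have tr_om p v : filt (fun s : zindex => om s.1) v p -> filt (fun=> th) v (trans c p).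
  apply: filt_morph => s; rewrite /= trans_var; apply: filtD.
    by apply: filt_mono; rewrite wtU.
  apply: (@filt_tfield R L (fun=> th)) => r rc <-.
  by rewrite wt_const; exact: c_le.
pose a (k : populated L) := coef (val b) (trans c (mono (val k) 1)).
apply: (@eq_holder _ _ _
  (fun s t => \sum_(k <- popfset L (mdeg (val b))) a k * x s t k)).
  move=> s t _ _ _; rewrite /translate (exp_actR rhoR _ _ (leqnn _)).
  rewrite /trunc [trans c _]linear_sum coef_sum; apply: eq_bigr => k _.
  by rewrite /= [trans c _]linearZ coefZ mulrC.
apply: holder_sum => k _; have [ak0|ak] := eqVneq (a k) 0.
  apply/holder_boundP; exists 0 => s t _ _ _.
  by rewrite ak0 !mul0r normr0.
apply: holder_scale; apply: holder_le (hx k).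
rewrite -wt_const; apply: (tr_om (mono (val k) 1)) => //.
exact: filt_mono.
Qed.

Lemma wt_wlength (Lt : {set L}) (alpha : R) (al : L -> R) (m : cmonom zindex) :
  wlength Lt alpha al m = wt (fun s => if s.1 \in Lt then al s.1 else alpha) m.
Proof.
rewrite /wlength /wt [RHS](partition_big (fun s => s.1) predT) //=.
rewrite [RHS](bigID (mem Lt)) /=; congr (_ + _).
  apply: eq_bigr => l lLt; rewrite natr_sum mulr_sumr.
  by apply: eq_bigr => s /eqP ->; rewrite lLt mulr_natr.
rewrite natr_sum mulr_sumr; apply: eq_bigr => l /negbTE lLt.
by rewrite natr_sum mulr_sumr; apply: eq_bigr => s /eqP ->; rewrite lLt mulr_natr.
Qed.

End TranslateHoelder.

Theorem theorem4p16 (R : realType) (L : finType) (hL : (0 < #|L|)%N)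
    (UT : guin_oudom (@Dprod R L)) (rhoD : env_rep UT (@Dprod R L))
    (UR : guin_oudom (@Rprod R L)) (rhoR : env_rep UR (@rho_tilde R L))
    (alpha : R) (halpha : 0 < alpha < 1)
    (x : R -> R -> populated L -> R) (hx : rough_path rhoD alpha x)
    (N : nat) (hN : (1 <= N)%N) :
  [/\ forall c : malg (rindex L) R, in_Rge2 N c ->
        rough_path rhoD (alpha / N%:R) (translate rhoR c x),
      forall (Lt : {set L}) (c : malg (rindex L) R),
        Lt != finset.set0 -> in_Rsub Lt N c ->
        rough_path rhoD (alpha / N%:R) (translate rhoR c x) &
      forall (Lt : {set L}) (c : malg (rindex L) R) (al : L -> R) (l0 : L),
        l0 \in Lt -> in_Rsub Lt N c ->
        (forall l, l \in Lt -> alpha <= al l) ->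
        (forall b : populated L,
          holder_bound (wlength Lt alpha al (val b)) (fun s t => x s t b)) ->
        rough_path rhoD
          (Num.min alpha ((\big[Num.min/al l0]_(l in Lt) al l) / N%:R))
          (translate rhoR c x)].
Proof.
case: hx => _ chen hold; have /andP[a0 a1] := halpha.
have N0 : 0 < N%:R :> R by rewrite ltr0n.
have N1 : 1 <= N%:R :> R by rewrite ler1n.
have chenT c s u t : 0 <= s -> s < u -> u < t -> t <= 1 -> forall b,
    translate rhoR c x s t b = translate rhoR c x s u b +
      exp_act rhoD (translate rhoR c x s u) (translate rhoR c x u t) b.
  by move=> s0 su ut t1; apply: chen_translate => b; exact: chen.
have divN (v : R) : 0 <= v -> v / N%:R <= v.
  by move=> v0; rewrite ler_pdivrMr // ler_peMr.
have short c : (forall r, r \in msupp c -> (mdeg (val r.1) <= N)%N) ->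
    rough_path rhoD (alpha / N%:R) (translate rhoR c x).
  move=> cN; split; first by rewrite divr_gt0 //= (le_lt_trans (divN _ (ltW a0))).
    exact: chenT.
  apply: (@holder_translate _ _ _ _ _ _ (fun=> alpha)) => [b|_|r /cN rN].
  - by rewrite wt_const.
  - exact: divN (ltW a0).
  - by rewrite mulrAC ler_pdivrMr // ler_pM2l // ler_nat.
split=> [c cN|Lt c _ cN|Lt c al l0 l0Lt cN al_ge hold'].
- by apply: short => r /cN /andP[].
- by apply: short => r /cN[].
set amin := \big[Num.min/al l0]_(l in Lt) al l.
have amin_le l : l \in Lt -> amin <= al l by move=> lLt; exact: bigmin_le_cond.
have amin_ge : alpha <= amin by apply: le_bigmin => [|l]; exact: al_ge.
have amin0 : 0 < amin by exact: lt_le_trans amin_ge.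
set th := Num.min _ _.
have th_alpha : th <= alpha by rewrite ge_min lexx.
have th_amin : th <= amin / N%:R by rewrite ge_min lexx orbT.
split.
- by rewrite lt_min a0 divr_gt0 //= (le_lt_trans th_alpha).
- exact: chenT.
apply: (@holder_translate _ _ _ _ _ _ (fun l => if l \in Lt then al l else alpha)).
- by move=> b; rewrite -wt_wlength.
- by move=> l; case: ifP => // /al_ge; exact: le_trans.
- move=> r /cN[rLt _ rN]; rewrite rLt; apply: le_trans (amin_le _ rLt).
  rewrite -[leRHS](divfK (lt0r_neq0 N0)).
  apply: ler_pM => //; last by rewrite ler_nat.
  by rewrite le_min (ltW a0) divr_ge0 ?ltW.
Qed.
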